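(* Let $0<\alpha<2$ and let $X=\{X(t):t\in\mathbb{R}\}$ be a stationary real harmonizable symmetric $\alpha$-stable process with finite control measure $m$, where $m$ is absolutely continuous with respect to Lebesgue measure on $\mathbb{R}$, with symmetric density $f$ and $m(\mathbb{R})=1$. Let $X$ be given by its series representation $X(t)=\sum_{k=1}^\infty R_k\cos(\Theta_k+tZ_k)$ (notation in the context). Let $h>0$. Then, for the lag process $\{X(t+h)-X(t):t\in\mathbb{R}\}$ and every $\lambda\in\mathbb{R}$, $$\lim_{T\to\infty}\frac1T\int_0^Te^{i\lambda(X(\tau+h)-X(\tau))}d\tau=\prod_{k=1}^\infty J_0\left(2\lambda R_k\sin\left(hZ_k/2\right)\right)\quad\text{almost surely},$$ where $J_0(s)=\frac1{2\pi}\int_{-\pi}^{\pi}e^{is\cos(u)}du$ is the Bessel function of the first kind of order $0$.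
   Context: Stationary real harmonizable symmetric $\alpha$-stable (SRH $S\alpha S$) process: $X(t)=\mathrm{Re}\left(\int_{\mathbb{R}}e^{itx}M(dx)\right)$, $t\in\mathbb{R}$, where $M$ is an isotropic complex $S\alpha S$ random measure on $\mathbb{R}$ with finite control measure $m$, i.e. $M$ is independently scattered, $\sigma$-additive, complex-valued, and for every Borel $A$ the vector $(\mathrm{Re}\,M(A),\mathrm{Im}\,M(A))$ has characteristic function $s\mapsto\exp\{-m(A)\int_{S^1}|(\theta,s)|^\alpha\gamma(d\theta)\}$ with $\gamma$ the uniform probability measure on the unit circle $S^1$. Equivalently, the finite-dimensional characteristic functions of $X$ are $\mathbb{E}\exp\{i\sum_j s_jX(t_j)\}=\exp\{-\lambda_\alpha\int_{\mathbb{R}}|\sum_{j,k}s_js_k\cos((t_k-t_j)x)|^{\alpha/2}m(dx)\}$, $\lambda_\alpha=\frac1{2\pi}\int_0^{2\pi}|\cos x|^\alpha dx$. Series representation: $X(t)=\sum_{k=1}^\infty R_k\cos(\Theta_k+tZ_k)$, where $\{\Gamma_k\}_{k\ge1}$ are the arrival times of a unit rate Poisson process, $\{G_k^{(1)}\}_{k\ge1},\{G_k^{(2)}\}_{k\ge1}$ are sequences of i.i.d. standard normal random variables, $\{Z_k\}_{k\ge1}$ are i.i.d. with law $m$ (density $f$), $\{\Theta_k\}_{k\ge1}$ are i.i.d. uniform on $(0,2\pi)$, all these sequences are mutually independent, and $$R_k=(C_\alpha b_\alpha^{-1}m(\mathbb{R}))^{1/\alpha}\Gamma_k^{-1/\alpha}\sqrt{(G_k^{(1)})^2+(G_k^{(2)})^2},$$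 $b_\alpha=2^{\alpha/2}\Gamma(1+\alpha/2)$, $C_\alpha=\left(\int_0^\infty x^{-\alpha}\sin(x)dx\right)^{-1}$. A measurable version of $X$ is used, so that the time integrals are defined. *)

(* Defs.v *)
From HB Require Import structures.
From mathcomp Require Import all_boot all_order all_algebra.
From mathcomp Require Import all_classical all_reals all_analysis.
From mathcomp Require Import measurable_realfun.
From mathcomp Require Import complex.

Set Implicit Arguments.
Unset Strict Implicit.
Unset Printing Implicit Defensive.

Import Order.TTheory GRing.Theory Num.Theory.
Import numFieldNormedType.Exports.

Local Open Scope classical_set_scope.
Local Open Scope ring_scope.
Local Open Scope complex_scope.

(** Complex-valued integrals *)

Definition cexpi (R : realType) (x : R) : R[i] := cos x +i* sin x.

Definition cintegral (d : measure_display) (S : measurableType d)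
    (R : realType) (mu : {measure set S -> \bar R}) (D : set S) (g : S -> R[i]) : R[i] :=
  Rintegral mu D (fun x => complex.Re (g x)) +i*
  Rintegral mu D (fun x => complex.Im (g x)).

(** Constants and special functions *)

Definition eulerGamma (R : realType) (s : R) : R :=
  Rintegral lebesgue_measure `]0, +oo[ (fun x : R => x `^ (s - 1) * expR (- x)).

(* The integral defining C_alpha is improper: for alpha <= 1 it converges only
   conditionally, hence the limit of integrals over bounded intervals. *)
Definition C_ (R : realType) (alpha : R) : R :=
  (lim (Rintegral lebesgue_measure `]0, b[
          (fun x : R => x `^ (- alpha) * sin x) @[b --> +oo]))^-1.

Definition b_ (R : realType) (alpha : R) : R :=
  2 `^ (alpha / 2) * eulerGamma (1 + alpha / 2).

Definition lambda_ (R : realType) (alpha : R) : R :=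
  (2 * pi)^-1 *
  Rintegral lebesgue_measure `[0, 2 * pi] (fun x : R => `|cos x| `^ alpha).

Definition besselJ0 (R : realType) (s : R) : R[i] :=
  ((2 * pi)^-1)%:C *
  cintegral lebesgue_measure `[- pi, pi] (fun u : R => cexpi (s * cos u)).

(** Independence and laws *)

Section independence.
Context (d : measure_display) (Omega : measurableType d) (R : realType).
Context (P : probability Omega R).

Definition mutually_independent (Y : nat -> {RV P >-> R}) : Prop :=
  forall (J : seq nat) (B : nat -> set R),
    uniq J -> (forall k, measurable (B k)) ->
    P (\bigcap_(k in [set` J]) (Y k @^-1` B k)) =
    (\prod_(k <- J) P (Y k @^-1` B k))%E.

Definition iid (Y : nat -> {RV P >-> R}) (mu : set R -> \bar R) : Prop :=
  mutually_independent Y /\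
  forall k (B : set R), measurable B -> distribution P (Y k) B = mu B.

Definition sigma_generated (Y : nat -> {RV P >-> R}) : set (set Omega) :=
  <<s [set A | exists k (B : set R), measurable B /\ A = Y k @^-1` B] >>.

Definition independent_sequences (n : nat)
    (Y : n.-tuple (nat -> {RV P >-> R})) : Prop :=
  forall A : 'I_n -> set Omega,
    (forall i, sigma_generated (tnth Y i) (A i)) ->
    P (\bigcap_(i in [set: 'I_n]) A i) = (\prod_(i < n) P (A i))%E.

(* Sequences are indexed from 0, so [Y k] is the (k+1)-st term. *)
Definition interarrival (Y : nat -> {RV P >-> R}) (k : nat) : {RV P >-> R} :=
  if k is j.+1 then (Y j.+1 \- Y j : {mfun Omega >-> R}) else Y 0%N.

Definition poisson_arrival_times (rate : R) (Y : nat -> {RV P >-> R}) : Prop :=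
  iid (interarrival Y) (exponential_prob rate).

End independence.

Lemma twopi_gt0 (R : realType) : 0 < 2 * pi :> R.
Proof. by rewrite mulr_gt0 // pi_gt0. Qed.

(** Harmonizable stable processes *)

Section harmonizable.
Context (d : measure_display) (Omega : measurableType d) (R : realType).
Context (P : probability Omega R) (alpha : R).
Context (m : {finite_measure set R -> \bar R}).

(* Being a stationary real harmonizable symmetric alpha-stable process with
   control measure [m] is a property of the finite-dimensional laws. *)
Definition SRH (X : R -> Omega -> R) : Prop :=
  forall (n : nat) (t s : 'I_n -> R),
    cintegral P setT (fun w => cexpi (\sum_(j < n) s j * X (t j) w)) =
    (expR (- (lambda_ alpha *
       Rintegral m setT (fun x : R =>
         `|\sum_(j < n) \sum_(k < n) s j * s k * cos ((t k - t j) * x)|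
           `^ (alpha / 2)))))%:C.

Definition amplitude (Gam G1 G2 : nat -> {RV P >-> R}) (k : nat) (w : Omega)
    : R :=
  (C_ alpha * (b_ alpha)^-1 * fine (m setT)) `^ (alpha^-1) *
  Gam k w `^ (- alpha^-1) * Num.sqrt (G1 k w ^+ 2 + G2 k w ^+ 2).

Definition series_variables (Gam G1 G2 Z Theta : nat -> {RV P >-> R}) : Prop :=
  [/\ poisson_arrival_times 1 Gam,
      iid G1 (normal_prob 0 1) /\ iid G2 (normal_prob 0 1),
      iid Z m,
      iid Theta (uniform_prob (twopi_gt0 R)) &
      independent_sequences [tuple Gam; G1; G2; Z; Theta]].

(* The series converges almost surely for each fixed time, and [X] is a jointly
   measurable version of its sum. *)
Definition measurable_series_version
    (Gam G1 G2 Z Theta : nat -> {RV P >-> R}) (X : R -> Omega -> R) : Prop :=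
  measurable_fun [set: R * Omega] (fun p : R * Omega => X p.1 p.2) /\
  forall t : R, {ae P, forall w,
    \sum_(0 <= k < n)
      amplitude Gam G1 G2 k w * cos (Theta k w + t * Z k w) @[n --> \oo]
      --> X t w}.

End harmonizable.

Definition symmetric_density (R : realType) (m : set R -> \bar R) (f : R -> R)
    : Prop :=
  [/\ measurable_fun setT f,
      forall x, 0 <= f x,
      forall x, f (- x) = f x &
      forall A : set R, measurable A ->
        m A = (\int[lebesgue_measure]_(x in A) (f x)%:E)%E].

(* Main.v *)
Require Import Defs.
From HB Require Import structures.
From mathcomp Require Import all_boot all_order all_algebra.
From mathcomp Require Import all_classical all_reals all_analysis.
From mathcomp Require Import measurable_realfun.
From mathcomp Require Import complex.
From mathcomp Require Import ring lra.

Import Order.TTheory GRing.Theory Num.Theory.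
Import numFieldNormedType.Exports.

Local Open Scope classical_set_scope.
Local Open Scope ring_scope.
Local Open Scope complex_scope.

(** Write [a_k = 2 R_k sin (h Z_k / 2)]. The k-th term of the lag process is the
    oscillation [a_k cos (Theta_k + (h Z_k + pi) / 2 + t Z_k)] ([lag_term]), so
    the theorem computes the asymptotic distribution over time of an almost
    periodic sum with random frequencies.

    For finitely many terms this is the Kronecker-Weyl theorem: the frequencies
    have a common law without atoms and are independent, hence almost surely
    linearly independent over the integers ([ae_rationally_independent]), the
    phases [t Z_k] equidistribute on a torus, and the time mean of
    [exp (i lambda (sum of n terms))] is the product of the first [n] factors
    [J0 (lambda a_k)] ([has_mean_quasiperiodic]). The product converges because
    [|J0 s - 1| <= s ^ 2] and [sum a_k ^ 2] is finite ([cvg_prod_J0]).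

    The passage to infinitely many terms needs, for almost every outcome, tails
    whose mean squares over [[0, T]] are small uniformly in [T]. Given the
    amplitudes and frequencies, a uniform phase may be translated by any
    independent amount without changing the law of a tail
    ([osc_phase_invariance]); hence tails are stationary in time, and their
    terms are orthogonal, so that their second moment is half the sum of the
    second moments of the amplitudes ([second_moment_osc]). For a stationary
    process, Garsia's maximal inequality ([maximal_inequality]) bounds the
    probability that some time average of the square exceeds [e] by the second
    moment divided by [e]. As the second moments of the tails tend to zero, there are
    almost surely arbitrarily late tails that stay small in mean square at all
    times ([tail_small_ae]), and the rest of the argument is deterministic
    ([pathwise_limit]).

    The amplitudes themselves may have infinite second moments for small [k], on
    account of the negative power of the arrival time. Since the arrival times
    eventually exceed [c k] for a constant [c] ([arrival_growth]), replacing
    [a_k] by zero when they do not alters finitely many terms, and the second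
    moments of the truncated amplitudes are of order [k ^ (- 2 / alpha)], which is
    summable for [alpha < 2] ([second_moment_truncated_lag_amplitude]). *)

Lemma le_of_eq {d : Order.disp_t} {T : porderType d} (x y : T) : x = y -> (x <= y)%O.
Proof. by move=> ->. Qed.

(** * Trigonometric approximation of phase modulation *)

Section trigonometry.
Context {R : realType}.
Implicit Types a b c x y u w p d e : R.

Lemma continuous_cos_comp (f : R -> R) : continuous f -> continuous (fun x => cos (f x)).
Proof. by move=> cf x; apply: continuous_comp; [exact: cf|exact: continuous_cos]. Qed.

Lemma continuous_sin_comp (f : R -> R) : continuous f -> continuous (fun x => sin (f x)).
Proof. by move=> cf x; apply: continuous_comp; [exact: cf|exact: continuous_sin]. Qed.

Lemma lipschitz_cos_lt a b : a < b -> `|cos b - cos a| <= b - a.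
Proof.
move=> ab.
have [//|c _ ->] := @MVT R (@cos R) (fun x => - sin x) a b ab.
  by apply: continuous_subspaceT => x; exact: continuous_cos.
rewrite normrM normrN (gtr0_norm (x := b - a)) ?subr_gt0//.
by rewrite ler_piMl ?subr_ge0 ?(ltW ab)// sin_max.
Qed.

Lemma lipschitz_cos a b : `|cos a - cos b| <= `|a - b|.
Proof.
have [ab|ba|->] := ltgtP a b; last by rewrite !subrr.
- by rewrite distrC (distrC a) (gtr0_norm (x := b - a)) ?subr_gt0// lipschitz_cos_lt.
- by rewrite (gtr0_norm (x := a - b)) ?subr_gt0// lipschitz_cos_lt.
Qed.

Lemma lipschitz_sin a b : `|sin a - sin b| <= `|a - b|.
Proof.
rewrite -!cosBpihalf (le_trans (lipschitz_cos _ _))//.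
by rewrite opprB addrA subrK.
Qed.

(** The first-order expansion of [exp (i (x + u))], with multiplication by [i]
    written as a quarter turn of the phase. *)
Lemma cos_linear_approx x u : `|cos (x + u) - (cos x + u * cos (x + pi / 2))| <= u ^+ 2.
Proof.
rewrite cosDpihalf mulrN.
have key p q : p < q -> `|cos q - cos p + (q - p) * sin x| <=
    (q - p) * Num.max `|p - x| `|q - x|.
  move=> pq.
  have [//|c] := @MVT R (@cos R) (fun x => - sin x) p q pq.
    by apply: continuous_subspaceT => y; exact: continuous_cos.
  rewrite in_itv/= => /andP[pc cq] ->.
  rewrite (_ : - sin c * (q - p) + (q - p) * sin x = (q - p) * (sin x - sin c)); last by ring.
  rewrite normrM gtr0_norm ?subr_gt0// ler_wpM2l ?subr_ge0 ?(ltW pq)//.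
  rewrite (le_trans (lipschitz_sin _ _))// distrC le_max.
  have [cx|xc] := leP c x; apply/orP.
    by left; rewrite !ler0_norm; lra.
  by right; rewrite !ger0_norm; lra.
have [u0|u0|->] := ltgtP u 0; last by rewrite addr0 mul0r oppr0 addr0 subrr normr0 expr0n.
- have := key (x + u) x; rewrite gtrDl => /(_ u0).
  rewrite (_ : x - (x + u) = - u); last by ring.
  rewrite (_ : x + u - x = u); last by ring.
  rewrite (_ : x - x = 0); last by ring.
  rewrite normr0 (ltr0_norm u0) max_l ?oppr_ge0 ?(ltW u0)// mulrNN -expr2; apply: le_trans.
  by rewrite -normrN; apply: le_of_eq; congr (`|_|); ring.
- have := key x (x + u); rewrite ltrDl => /(_ u0).
  rewrite (_ : x + u - x = u); last by ring.
  rewrite (_ : x - x = 0); last by ring.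
  rewrite normr0 (gtr0_norm u0) max_r ?(ltW u0)// -expr2; apply: le_trans.
  by apply: le_of_eq; congr (`|_|); ring.
Qed.

Lemma one_sub_cos_le u : 1 - cos u <= u ^+ 2.
Proof.
have := cos_linear_approx 0 u; rewrite add0r cos0 add0r cos_pihalf mulr0 addr0.
by apply: le_trans; rewrite distrC ler_norm.
Qed.

(** A triple [(A, s, k)] encodes [A cos (x + s + k p)]. The phase [x] common to
    all terms is kept apart from the list: approximations uniform in [x] can
    then be used with a time-dependent [x]. *)
Definition trig_sum (s : seq (R * R * int)) x p : R :=
  \sum_(q <- s) q.1.1 * cos (x + q.1.2 + q.2%:~R * p).

Lemma trig_sum_cat (s t : seq (R * R * int)) x p : trig_sum (s ++ t) x p = trig_sum s x p + trig_sum t x p.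
Proof. exact: big_cat. Qed.

(** Product-to-sum: a trigonometric sum times [cos p] is again one. *)
Definition trig_sum_mulcos d (s : seq (R * R * int)) : seq (R * R * int) :=
  [seq (d / 2 * q.1.1, q.1.2 + pi / 2, (q.2 + 1)%R) | q <- s] ++
  [seq (d / 2 * q.1.1, q.1.2 + pi / 2, (q.2 - 1)%R) | q <- s].

Lemma trig_sum_mulcosE d s x p :
  trig_sum (trig_sum_mulcos d s) x p = d * cos p * trig_sum s (x + pi / 2) p.
Proof.
rewrite trig_sum_cat /trig_sum !big_map -big_split/= mulr_sumr.
apply: eq_bigr => q _.
rewrite (_ : x + (q.1.2 + pi / 2) + (q.2 + 1)%:~R * p =
             (x + pi / 2 + q.1.2 + q.2%:~R * p) + p); last by rewrite intrD; ring.
rewrite (_ : x + (q.1.2 + pi / 2) + (q.2 - 1)%:~R * p =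
             (x + pi / 2 + q.1.2 + q.2%:~R * p) - p); last by rewrite intrB; ring.
by rewrite cosD cosB; field.
Qed.

Fixpoint trig_iter d (n : nat) : seq (R * R * int) :=
  if n is n'.+1 then trig_iter d n' ++ trig_sum_mulcos d (trig_iter d n')
  else [:: (1, 0, 0%R)].

(** By [exp (i n u) = (exp (i u)) ^ n] and [exp (i u) = 1 + i u + O(u ^ 2)] for
    [u = d cos p]; the factor [1 + |d|] is the growth of earlier errors in one
    step. *)
Lemma trig_iter_approx d n x p :
  `|cos (x + n%:R * d * cos p) - trig_sum (trig_iter d n) x p|
    <= n%:R * d ^+ 2 * (1 + `|d|) ^+ n.
Proof.
elim: n x => [|n ih] x.
  by rewrite /trig_sum big_seq1/= !mul0r !addr0 mul1r subrr normr0.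
rewrite /= trig_sum_cat trig_sum_mulcosE.
set A := trig_sum _ x p; set B := trig_sum _ _ p.
set y := x + n%:R * d * cos p.
set u := d * cos p.
have -> : x + n.+1%:R * d * cos p = y + u by rewrite /y /u -natr1; ring.
have h1 := cos_linear_approx y u.
have h2 := ih x; have h3 := ih (x + pi / 2).
rewrite -/A -/y in h2.
rewrite (addrAC x) -/B -/y in h3.
set e := n%:R * d ^+ 2 * (1 + `|d|) ^+ n in h2 h3.
have ud : `|u| <= `|d| by rewrite normrM ler_piMr// cos_max.
have u2 : u ^+ 2 <= d ^+ 2 by rewrite -(real_normK (num_real u)) -(real_normK (num_real d)) lerXn2r ?nnegrE.
have e0 : 0 <= e by exact: le_trans h2.
have : `|cos (y + u) - (A + u * B)| <= d ^+ 2 + e + `|d| * e.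
  rewrite (_ : cos (y + u) - (A + u * B) = (cos (y + u) - (cos y + u * cos (y + pi / 2)))
     + (cos y - A) + u * (cos (y + pi / 2) - B)); last by ring.
  rewrite (le_trans (ler_normD _ _))// lerD//.
    by rewrite (le_trans (ler_normD _ _))// lerD// (le_trans h1).
  by rewrite normrM ler_pM.
move/le_trans; apply.
have -> : d ^+ 2 + e + `|d| * e = d ^+ 2 + e * (1 + `|d|) by ring.
have -> : n.+1%:R * d ^+ 2 * (1 + `|d|) ^+ n.+1 =
    d ^+ 2 * (1 + `|d|) ^+ n.+1 + e * (1 + `|d|) by rewrite /e (exprS (1 + `|d|)) -natr1; ring.
by rewrite lerD2r ler_peMr ?sqr_ge0// exprn_ege1// lerDl.
Qed.

(** A crude form of the Jacobi-Anger expansion: uniformly in [x] and [p], the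
    modulated cosine is approximated by finitely many harmonics of [p]. *)
Lemma trig_approx b e : 0 < e -> exists s : seq (R * R * int),
  forall x p, `|cos (x + b * cos p) - trig_sum s x p| <= e.
Proof.
move=> e0.
(* With increment b / N, the error after N steps is at most
   N (b / N) ^ 2 (1 + |b| / N) ^ N <= b ^ 2 exp |b| / N. *)
pose N := (Num.truncn (b ^+ 2 * expR `|b| / e)).+1.
have N0 : 0 < N%:R :> R by rewrite ltr0n.
have hN : b ^+ 2 * expR `|b| / e <= N%:R by rewrite ltW// /N truncnS_gt.
exists (trig_iter (b / N%:R) N) => x p.
have := trig_iter_approx (b / N%:R) N x p.
rewrite (mulrC N%:R (b / _)) divfK ?gt_eqF//.
move/le_trans; apply.
have : (1 + `|b / N%:R|) ^+ N <= expR `|b|.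
  have -> : `|b| = `|b / N%:R| * N%:R.
    by rewrite normrM (gtr0_norm (x := _^-1)) ?invr_gt0// divfK ?gt_eqF.
  rewrite expRM_natr lerXn2r ?nnegrE ?addr_ge0 ?expR_ge0//; exact: expR_ge1Dx.
move=> h; rewrite (le_trans (ler_wpM2l _ h))//.
  by rewrite mulr_ge0 ?sqr_ge0.
rewrite (_ : _ * _ * _ = b ^+ 2 * expR `|b| / N%:R); last first.
  by field; rewrite pnatr_eq0.
by rewrite ler_pdivrMr// [leRHS]mulrC -ler_pdivrMr.
Qed.

End trigonometry.

(** * Time means *)

Section integrals.
Context {R : realType}.
Local Notation mu := (@lebesgue_measure R).

(** The class of functions used for all means over bounded intervals: integrable
    there, and stable under the operations that occur. *)
Definition bounded_measurable (g : R -> R) :=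
  measurable_fun setT g /\ exists C : R, forall t, `|g t| <= C.

Lemma bounded_measurable_integrable g (a b : R) : bounded_measurable g ->
  mu.-integrable `[a, b] (EFin \o g).
Proof.
move=> [mg [C gC]]; apply: measurable_bounded_integrable => //=.
- by rewrite lebesgue_measure_itv/=; case: ifP => //=; rewrite -EFinB ltry.
- exact: measurable_funTS.
- exists C; split; first exact: num_real.
  by move=> M CM x _ /=; rewrite (le_trans (gC x))// ltW.
Qed.

Lemma bounded_measurable_continuous g C : continuous g -> (forall t, `|g t| <= C) ->
  bounded_measurable g.
Proof. by move=> cg gC; split; [exact: continuous_measurable_fun|exists C]. Qed.

Lemma bounded_measurableD g1 g2 : bounded_measurable g1 -> bounded_measurable g2 ->
  bounded_measurable (fun t => g1 t + g2 t).
Proof.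
move=> [m1 [C1 b1]] [m2 [C2 b2]]; split; first exact: measurable_funD.
by exists (C1 + C2) => t; rewrite (le_trans (ler_normD _ _))// lerD.
Qed.

Lemma bounded_measurableZ r g : bounded_measurable g ->
  bounded_measurable (fun t => r * g t).
Proof.
move=> [m1 [C1 b1]]; split; first exact: measurable_funM.
by exists (`|r| * C1) => t; rewrite normrM ler_wpM2l.
Qed.

Lemma bounded_measurableB g1 g2 : bounded_measurable g1 -> bounded_measurable g2 ->
  bounded_measurable (fun t => g1 t - g2 t).
Proof.
move=> [m1 [C1 b1]] [m2 [C2 b2]]; split; first exact: measurable_funB.
by exists (C1 + C2) => t; rewrite (le_trans (ler_normB _ _))// lerD.
Qed.

Lemma bounded_measurable_cst r : bounded_measurable (fun=> r).
Proof. by split; [exact: measurable_cst|exists `|r|]. Qed.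

Lemma Rintegral_itv_cst (a b r : R) : a <= b ->
  Rintegral mu `[a, b] (fun=> r) = r * (b - a).
Proof.
move=> ab; rewrite Rintegral_cst//= lebesgue_measure_itv/= lte_fin.
by case: ltgtP ab => // -> _; rewrite subrr.
Qed.

Lemma Rintegral_FTC (f F : R -> R) (a b : R) : a <= b -> continuous f ->
  (forall x : R, is_derive x 1 F (f x)) -> Rintegral mu `[a, b] f = F b - F a.
Proof.
rewrite le_eqVlt => /predU1P[->|ab] cf dF.
  by rewrite subrr set_itv1 Rintegral_set1.
have cF : continuous F.
  by move=> x; apply: differentiable_continuous; apply/derivable1_diffP; apply: ex_derive.
rewrite /Rintegral (continuous_FTC2 (F := F))//.
- by apply: continuous_subspaceT => x; exact: cf.
- split => [x _||].
  + exact: ex_derive.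
  + by apply: cvg_at_right_filter; exact: cF.
  + by apply: cvg_at_left_filter; exact: cF.
- by move=> x _; rewrite derive1E; exact: derive_val.
Qed.

Lemma Rintegral_cos_linear (c w a b : R) : a <= b -> w != 0 ->
  Rintegral mu `[a, b] (fun t => cos (c + w * t)) =
  w^-1 * (sin (c + w * b) - sin (c + w * a)).
Proof.
move=> ab w0; have cf : continuous (fun t : R => cos (c + w * t)).
  apply: continuous_cos_comp => x; apply: cvgD; first exact: cvg_cst.
  by apply: cvgM; [exact: cvg_cst|exact: cvg_id].
have dF (x : R) : is_derive x 1 (fun t : R => w^-1 * sin (c + w * t)) (cos (c + w * x)).
  have H : is_derive x 1 (fun t : R => c + w * t) w.
    by apply: is_derive_eq; rewrite /GRing.scale/=; ring.
  apply: is_derive_eq; rewrite /GRing.scale/=.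
  by field.
by rewrite (Rintegral_FTC _ _ _ _ ab cf dF) mulrBr.
Qed.

Lemma Rintegral_sup_le g g' (e a b : R) : a <= b ->
  bounded_measurable g -> bounded_measurable g' ->
  (forall t, `|g t - g' t| <= e) ->
  `|Rintegral mu `[a, b] g - Rintegral mu `[a, b] g'| <= e * (b - a).
Proof.
move=> ab bg bg' ge.
rewrite -RintegralB//=; [|exact: bounded_measurable_integrable..].
have bgg := bounded_measurableB _ _ bg bg'.
rewrite (le_trans (le_normr_Rintegral _ _))//; first exact: bounded_measurable_integrable.
rewrite -(Rintegral_itv_cst a b e ab) le_Rintegral//.
- apply: (bounded_measurable_integrable (fun t => `|g t - g' t|)).
  case: bgg => mgg [C hC]; split; first exact: measurableT_comp.
  by exists C => t; rewrite normr_id.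
- exact: bounded_measurable_integrable (bounded_measurable_cst e).
Qed.

Definition time_mean (g : R -> R) T : R := T^-1 * Rintegral mu `[0, T] g.

Definition has_mean (g : R -> R) (l : R) := time_mean g T @[T --> +oo] --> l.

Lemma has_mean_cst r : has_mean (fun=> r) r.
Proof.
apply: cvg_near_cst; near=> T.
have T0 : 0 < T by near: T; exact: nbhs_pinfty_gt.
by rewrite /time_mean Rintegral_itv_cst ?ltW// subr0 mulrC mulfK ?gt_eqF.
Unshelve. all: by end_near. Qed.

Lemma has_meanD g1 g2 l1 l2 : bounded_measurable g1 -> bounded_measurable g2 ->
  has_mean g1 l1 -> has_mean g2 l2 -> has_mean (fun t => g1 t + g2 t) (l1 + l2).
Proof.
move=> b1 b2 h1 h2; rewrite /has_mean.
have -> : time_mean (fun t => g1 t + g2 t) = (fun T => time_mean g1 T + time_mean g2 T).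
  apply/funext => T; rewrite /time_mean RintegralD ?mulrDr//;
  exact: bounded_measurable_integrable.
exact: cvgD.
Qed.

Lemma has_meanZ r g l : bounded_measurable g -> has_mean g l ->
  has_mean (fun t => r * g t) (r * l).
Proof.
move=> b1 h1; rewrite /has_mean.
have -> : time_mean (fun t => r * g t) = (fun T => r * time_mean g T).
  apply/funext => T; rewrite /time_mean RintegralZl//; first by rewrite mulrCA.
  exact: bounded_measurable_integrable.
by apply: cvgM => //; exact: cvg_cst.
Qed.

Lemma has_mean_sum (I : Type) (s : seq I) (g : I -> R -> R) (l : I -> R) :
  (forall i, bounded_measurable (g i)) -> (forall i, has_mean (g i) (l i)) ->
  bounded_measurable (fun t => \sum_(i <- s) g i t) /\
  has_mean (fun t => \sum_(i <- s) g i t) (\sum_(i <- s) l i).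
Proof.
move=> bg hg; elim: s => [|i s [ihb ihm]].
  rewrite big_nil (_ : (fun t => _) = (fun=> 0)); last by apply/funext => t; rewrite big_nil.
  by split; [exact: bounded_measurable_cst|exact: has_mean_cst].
rewrite big_cons (_ : (fun t => _) = (fun t => g i t + \sum_(i <- s) g i t)); last first.
  by apply/funext => t; rewrite big_cons.
by split; [exact: bounded_measurableD|exact: has_meanD].
Qed.

(** The functions with a mean value form a uniformly closed class. *)
Lemma has_mean_uniform_limit g l : bounded_measurable g ->
  (forall e : R, 0 < e -> exists g' l', [/\ bounded_measurable g', has_mean g' l',
     forall t, `|g t - g' t| <= e & `|l - l'| <= e]) ->
  has_mean g l.
Proof.
move=> bg H; apply/cvgrPdist_le => e /= e0.
have e3 : 0 < e / 3 by rewrite divr_gt0.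
have [g' [l' [bg' hg' gg' ll']]] := H _ e3.
near=> T.
have T0 : 0 < T by near: T; exact: nbhs_pinfty_gt.
have hT : `|l' - time_mean g' T| <= e / 3.
  by near: T; move/cvgrPdist_le : hg'; apply.
have hT' : `|time_mean g' T - time_mean g T| <= e / 3.
  rewrite /time_mean -mulrBr normrM gtr0_norm ?invr_gt0// mulrC ler_pdivrMr//.
  have := @Rintegral_sup_le g' g (e / 3) 0 T; rewrite subr0; apply; rewrite ?ltW//.
  by move=> t; rewrite distrC.
rewrite (_ : l - _ = (l - l') + (l' - time_mean g' T) + (time_mean g' T - time_mean g T)); last by ring.
rewrite (le_trans (ler_normD _ _))// (_ : e = e / 3 + e / 3 + e / 3); last by field.
by rewrite lerD// (le_trans (ler_normD _ _))// lerD.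
Unshelve. all: by end_near. Qed.

Lemma has_mean_cos (c w : R) : w != 0 -> has_mean (fun t => cos (c + w * t)) 0.
Proof.
move=> w0; apply/cvgrPdist_le => e e0; near=> T.
have T0 : 0 < T by near: T; exact: nbhs_pinfty_gt.
rewrite sub0r normrN /time_mean (Rintegral_cos_linear _ _ _ _ (ltW T0) w0) normrM gtr0_norm ?invr_gt0//.
rewrite mulrC ler_pdivrMr//.
rewrite (@le_trans _ _ (2 / `|w|))//.
  rewrite normrM normfV mulrC ler_wpM2r ?invr_ge0//.
  by rewrite (le_trans (ler_normB _ _))// (_ : 2 = 1 + 1)// lerD ?sin_max.
by rewrite [leRHS]mulrC -ler_pdivrMr//; near: T; apply: nbhs_pinfty_ge; exact: num_real.
Unshelve. all: by end_near. Qed.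

End integrals.

(** * Translation of Lebesgue integrals *)

Section translation.
Context {R : realType}.
Local Notation mu := (@lebesgue_measure R).

Lemma lebesgue_measure_translation (c : R) (A : set R) : measurable A ->
  pushforward mu ((fun x => x + c) : R -> measurableTypeR R) A = mu A.
Proof.
have mf : measurable_fun setT ((fun x => x + c) : R -> measurableTypeR R).
  by apply: measurable_funD => //; exact: measurable_id.
move=> mA; apply/esym/(@lebesgue_measure_unique R (measure_function_pushforward__canonical__measure_function_Measure mu mf)) => //= _ [[a b]] _ <-.
rewrite /pushforward.
rewrite (_ : _ @^-1` _ = [set` `](a - c), (b - c)]]); last first.
  by apply/seteqP; split => x/=; rewrite !in_itv/= ltrBlDr lerBrDr.
rewrite !lebesgue_measure_itv/= !lte_fin ltrD2r -!EFinB.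
by case: ifP => // _; congr EFin; ring.
Qed.

End translation.

Lemma integral_translation (R : realType) (c : R) (D : set R) (f : R -> \bar R) :
  measurable D -> measurable_fun setT f -> (lebesgue_measure).-integrable [set x | D (x + c)] (fun x => f (x + c)) ->
  (\int[lebesgue_measure]_(x in D) f x = \int[lebesgue_measure]_(x in [set x | D (x + c)%R]) f (x + c)%R)%E.
Proof.
move=> mD mf intf.
pose phi : measurableTypeR R -> measurableTypeR R := fun x : R => x + c.
have mphi : measurable_fun setT phi by apply: (@measurable_funD _ R R) => //; exact: measurable_id.
have E := @integral_pushforward _ _ _ _ R phi mphi (@lebesgue_measure R) D f mf intf mD.
apply: etrans E.
by apply: eq_measure_integral => A mA _; exact/esym/lebesgue_measure_translation.
Qed.

Lemma ge0_integral_translation (R : realType) (c : R) (D : set R) (f : R -> \bar R) :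
  measurable D -> measurable_fun setT f -> (forall x, 0%E <= f x)%E ->
  (\int[lebesgue_measure]_(x in D) f x = \int[lebesgue_measure]_(x in [set x | D (x + c)%R]) f (x + c)%R)%E.
Proof.
move=> mD mf f0.
pose phi : measurableTypeR R -> measurableTypeR R := fun x : R => x + c.
have mphi : measurable_fun setT phi by apply: (@measurable_funD _ R R) => //; exact: measurable_id.
have E := @ge0_integral_pushforward _ _ _ _ R phi mphi (@lebesgue_measure R) D f mD (measurable_funTS mf) (fun y _ => f0 y).
apply: etrans E.
by apply: eq_measure_integral => A mA _; exact/esym/lebesgue_measure_translation.
Qed.

(** * Means over a period and the Bessel function *)

Section torus.
Context {R : realType}.
Local Notation mu := (@lebesgue_measure R).

(** Mean value over one period. *)
Definition circle_mean (g : R -> R) : R := (2 * pi)^-1 * Rintegral mu `[- pi, pi] g.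

Lemma pi_itv_le : - pi <= pi :> R.
Proof. by rewrite (le_trans (y := 0)) ?oppr_le0 ?pi_ge0. Qed.

Lemma circle_mean_cst (r : R) : circle_mean (fun=> r) = r.
Proof.
rewrite /circle_mean Rintegral_itv_cst ?pi_itv_le//.
rewrite (_ : pi - - pi = 2 * pi); last by ring.
by rewrite mulrC mulfK// lt0r_neq0// mulr_gt0 ?pi_gt0.
Qed.

Lemma circle_meanD g1 g2 : bounded_measurable g1 -> bounded_measurable g2 ->
  circle_mean (fun t => g1 t + g2 t) = circle_mean g1 + circle_mean g2.
Proof.
by move=> b1 b2; rewrite /circle_mean RintegralD ?mulrDr//;
  exact: bounded_measurable_integrable.
Qed.

Lemma circle_meanZ r g : bounded_measurable g ->
  circle_mean (fun t => r * g t) = r * circle_mean g.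
Proof.
move=> b1; rewrite /circle_mean RintegralZl//; first by rewrite mulrCA.
exact: bounded_measurable_integrable.
Qed.

Lemma circle_mean_sum (I : Type) (s : seq I) (g : I -> R -> R) :
  (forall i, bounded_measurable (g i)) ->
  bounded_measurable (fun t => \sum_(i <- s) g i t) /\
  circle_mean (fun t => \sum_(i <- s) g i t) = \sum_(i <- s) circle_mean (g i).
Proof.
move=> bg; elim: s => [|i s [ihb ihm]].
  rewrite big_nil (_ : (fun t => _) = (fun=> 0)); last by apply/funext => t; rewrite big_nil.
  by split; [exact: bounded_measurable_cst|exact: circle_mean_cst].
rewrite big_cons (_ : (fun t => _) = (fun t => g i t + \sum_(i <- s) g i t)); last first.
  by apply/funext => t; rewrite big_cons.
by split; [exact: bounded_measurableD|rewrite circle_meanD// ihm].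
Qed.

Lemma circle_mean_sup_le g g' (e : R) :
  bounded_measurable g -> bounded_measurable g' ->
  (forall t, `|g t - g' t| <= e) -> `|circle_mean g - circle_mean g'| <= e.
Proof.
move=> bg bg' ge; rewrite /circle_mean -mulrBr normrM.
have p0 : 0 < 2 * pi :> R by rewrite mulr_gt0 ?pi_gt0.
rewrite gtr0_norm ?invr_gt0// mulrC ler_pdivrMr//.
have := @Rintegral_sup_le R g g' e _ _ pi_itv_le bg bg' ge.
by rewrite opprK (_ : pi + pi = 2 * pi)//; ring.
Qed.

Lemma sin_natpi (n : nat) : sin (n%:R * pi) = 0 :> R.
Proof.
by elim: n => [|n ih]; rewrite ?mul0r ?sin0// -natr1 mulrDl mul1r sinDpi ih oppr0.
Qed.

Lemma sin_intpi (n : int) : sin (n%:~R * pi) = 0 :> R.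
Proof.
case: n => n; first exact: sin_natpi.
by rewrite NegzE mulrNz mulNr sinN; apply/eqP; rewrite oppr_eq0; apply/eqP; exact: sin_natpi.
Qed.

Lemma circle_mean_cos (x : R) (n : int) :
  circle_mean (fun u => cos (x + n%:~R * u)) = if n == 0 then cos x else 0.
Proof.
case: ifPn => [/eqP ->|n0].
  rewrite (_ : (fun u => _) = (fun=> cos x)) ?circle_mean_cst//.
  by apply/funext => u; rewrite mul0r addr0.
rewrite /circle_mean Rintegral_cos_linear ?pi_itv_le ?intr_eq0//.
rewrite mulrN sinB sinD sin_intpi mulr0 addr0 subr0 subrr.
by rewrite !mulr0.
Qed.

Lemma continuous_affine (c w : R) : continuous (fun t : R => c + w * t).
Proof.
move=> x; apply: cvgD; first exact: cvg_cst.
by apply: cvgM; [exact: cvg_cst|exact: cvg_id].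
Qed.

Lemma bounded_measurable_cos (f : R -> R) : continuous f ->
  bounded_measurable (fun t => cos (f t)).
Proof.
move=> cf; apply: (@bounded_measurable_continuous _ _ 1); first exact: continuous_cos_comp.
by move=> t; exact: cos_max.
Qed.

Lemma bounded_measurable_sin (f : R -> R) : continuous f ->
  bounded_measurable (fun t => sin (f t)).
Proof.
move=> cf; apply: (@bounded_measurable_continuous _ _ 1); first exact: continuous_sin_comp.
by move=> t; exact: sin_max.
Qed.

Lemma continuous_mulcos (s : R) : continuous (fun u : R => s * cos u).
Proof.
by move=> x; apply: cvgM; [exact: cvg_cst|exact: continuous_cos].
Qed.

(** The integrand changes sign under the translation by [pi], which exchanges the
    two halves of the period. *)
Lemma circle_mean_sin_cos (s : R) : circle_mean (fun u => sin (s * cos u)) = 0.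
Proof.
pose g := fun u : R => sin (s * cos u).
have bg : bounded_measurable g by apply: bounded_measurable_sin; exact: continuous_mulcos.
have gpi u : g (u + pi) = - g u by rewrite /g cosDpi mulrN sinN.
have ig a b := bounded_measurable_integrable _ a b bg.
have shiftpi : Rintegral mu `[0, pi] g = - Rintegral mu `[- pi, 0] g.
  rewrite -mulN1r -RintegralZl//.
  rewrite /Rintegral; congr fine.
  have pre : [set x : R | [set` `[0, pi]] (x + pi)] = [set` `[- pi, 0]].
    by apply/seteqP; split => x/=; rewrite !in_itv/=; lra.
  rewrite (@integral_translation R pi _ (EFin \o g))//.
  - by rewrite pre; apply: eq_integral => x _ /=; rewrite gpi mulN1r.
  - by case: bg => mg _; exact/measurable_EFinP.
  - rewrite pre (_ : (fun x => _) = EFin \o (fun x => -1 * g x)).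
      exact: bounded_measurable_integrable (bounded_measurableZ _ _ bg).
    by apply/funext => x /=; rewrite gpi mulN1r.
have := @Rintegral_itvB R g (BLeft (- pi)) (BRight pi) 0 (ig _ _).
rewrite !bnd_simp => /(_ _ _)/esym.
rewrite -Rintegral_itv_obnd_cbnd in shiftpi.
  rewrite shiftpi => H.
  rewrite /circle_mean (_ : Rintegral _ _ _ = 0) ?mulr0//.
  have := H _ _; rewrite oppr_le0 pi_ge0 => /(_ isT isT).
  rewrite -/g; move: (Rintegral mu `[- pi, pi] g) (Rintegral mu `[- pi, 0] g) => p q; lra.
by apply: integrableS (ig 0 pi) => //; apply: subset_itv; rewrite bnd_simp.
Qed.


(** The real form of [besselJ0], whose imaginary part vanishes. *)
Definition J0 (s : R) : R := circle_mean (fun u => cos (s * cos u)).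

Lemma besselJ0E (s : R) : besselJ0 s = (J0 s)%:C.
Proof.
rewrite /besselJ0 /cintegral /=.
have := circle_mean_sin_cos s; rewrite /J0 /circle_mean => H.
move: H; set p := Rintegral _ _ _; set q := Rintegral _ _ _ => H.
by apply/eqP; rewrite eq_complex /= !mul0r subr0 addr0 H !eqxx.
Qed.

Lemma circle_mean_cos_shift (x s : R) :
  circle_mean (fun u => cos (x + s * cos u)) = cos x * J0 s.
Proof.
rewrite (_ : (fun u => _) = (fun u => cos x * cos (s * cos u) + (- sin x) * sin (s * cos u))).
  have b1 : bounded_measurable (fun u : R => cos (s * cos u)).
    by apply: bounded_measurable_cos; exact: continuous_mulcos.
  have b2 : bounded_measurable (fun u : R => sin (s * cos u)).
    by apply: bounded_measurable_sin; exact: continuous_mulcos.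
  rewrite circle_meanD; [|exact: bounded_measurableZ..].
  by rewrite !circle_meanZ// circle_mean_sin_cos mulr0 addr0.
by apply/funext => u; rewrite cosD mulNr.
Qed.

Lemma norm_J0_le1 (s : R) : `|J0 s| <= 1.
Proof.
have := @circle_mean_sup_le (fun u => cos (s * cos u)) (fun=> 0) 1.
rewrite circle_mean_cst subr0; apply.
- by apply: bounded_measurable_cos; exact: continuous_mulcos.
- exact: bounded_measurable_cst.
- by move=> t; rewrite subr0; exact: cos_max.
Qed.

(** Square summable arguments make the product of the Bessel factors converge. *)
Lemma norm_J0_sub1_le (s : R) : `|J0 s - 1| <= s ^+ 2.
Proof.
have := @circle_mean_sup_le (fun u => cos (s * cos u)) (fun=> 1) (s ^+ 2).
rewrite circle_mean_cst; apply.
- by apply: bounded_measurable_cos; exact: continuous_mulcos.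
- exact: bounded_measurable_cst.
- move=> t; rewrite distrC ger0_norm ?subr_ge0 ?cos_le1//.
  by rewrite (le_trans (one_sub_cos_le _))// exprMn ler_piMr ?sqr_ge0//.
Qed.

Lemma bounded_measurable_trig_sum (s : seq (R * R * int)) (x : R) :
  bounded_measurable (trig_sum s x).
Proof.
have bg (q : R * R * int) : bounded_measurable (fun p => q.1.1 * cos (x + q.1.2 + q.2%:~R * p)).
  by apply: bounded_measurableZ; apply: bounded_measurable_cos; exact: continuous_affine.
by have [] := circle_mean_sum _ s _ bg.
Qed.

Lemma circle_mean_trig_sum (s : seq (R * R * int)) (x : R) :
  circle_mean (trig_sum s x) =
  \sum_(q <- s) q.1.1 * (if q.2 == 0 then cos (x + q.1.2) else 0).
Proof.
have bc (q : R * R * int) : bounded_measurable (fun p => cos (x + q.1.2 + q.2%:~R * p)).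
  by apply: bounded_measurable_cos; exact: continuous_affine.
have [_ ->] := circle_mean_sum _ s _ (fun q => bounded_measurableZ q.1.1 _ (bc q)).
by apply: eq_bigr => q _; rewrite circle_meanZ// circle_mean_cos.
Qed.

End torus.

(** * The Kronecker-Weyl theorem *)

Section kronecker_weyl.
Context {R : realType}.

(** Integer coefficients suffice, after clearing denominators. *)
Definition rationally_independent (z : nat -> R) :=
  forall (K : nat) (n : nat -> int), \sum_(0 <= i < K) (n i)%:~R * z i = 0 ->
    forall i, (i < K)%N -> n i = 0.

(** The continuous Kronecker-Weyl theorem for phase-modulated oscillations.
    The additional frequency [w], which is either zero or outside the group
    generated by the [z i], makes an induction on the number of factors
    possible: expanding the last factor into trigonometric terms moves a multiple
    of its frequency into [w]. *)
Lemma has_mean_quasiperiodic (z : nat -> R) (b th : nat -> R) (K : nat) (c w : R) :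
  rationally_independent z ->
  w = 0 \/ (forall n : nat -> int, w <> \sum_(0 <= i < K) (n i)%:~R * z i) ->
  has_mean (fun t => cos (c + w * t + \sum_(0 <= i < K) b i * cos (th i + z i * t)))
    (if w == 0 then cos c * \prod_(0 <= i < K) J0 (b i) else 0).
Proof.
move=> zi; elim: K c w => [|K ih] c w hw.
  rewrite big_nil mulr1.
  rewrite (_ : (fun t => _) = fun t => cos (c + w * t)); last first.
    by apply/funext => t; rewrite big_nil addr0.
  case: ifPn => [/eqP->|]; last exact: has_mean_cos.
  rewrite (_ : (fun t => _) = fun=> cos c); first exact: has_mean_cst.
  by apply/funext => t; rewrite mul0r addr0.
have cS L : continuous (fun t : R => \sum_(0 <= i < L) b i * cos (th i + z i * t)).
  move=> x; elim: L => [|L ihL].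
    rewrite (_ : (fun t => _) = (fun=> 0)); first exact: cvg_cst.
    by apply/funext => t; rewrite big_nil.
  rewrite (_ : (fun t => _) = (fun t => \sum_(0 <= i < L) b i * cos (th i + z i * t) +
      b L * cos (th L + z L * t))); last by apply/funext => t; rewrite big_nat_recr.
  apply: cvgD => //; apply: cvgM; first exact: cvg_cst.
  exact: (continuous_cos_comp _ (continuous_affine _ _)).
have bS L c' w' : bounded_measurable
    (fun t : R => cos (c' + w' * t + \sum_(0 <= i < L) b i * cos (th i + z i * t))).
  apply: bounded_measurable_cos => x; apply: cvgD; last exact: cS.
  exact: continuous_affine.
apply: has_mean_uniform_limit => // e e0.
have [s hs] := trig_approx (b K) e e0.
pose g (q : R * R * int) (t : R) := q.1.1 *
  cos ((c + q.1.2 + q.2%:~R * th K) + (w + q.2%:~R * z K) * t +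
    \sum_(0 <= i < K) b i * cos (th i + z i * t)).
pose l (q : R * R * int) := q.1.1 *
  (if w + q.2%:~R * z K == 0 then cos (c + q.1.2 + q.2%:~R * th K) *
      \prod_(0 <= i < K) J0 (b i) else 0).
have bg q : bounded_measurable (g q) by apply: bounded_measurableZ; exact: bS.
have hgl q : has_mean (g q) (l q).
  apply: has_meanZ; first exact: bS.
  apply: ih; case: hw => [->|hw].
    rewrite add0r; have [->|q0] := eqVneq q.2 0; first by left; rewrite mul0r.
    (* A nonzero multiple of z_K is not an integer combination of z_0, ..., z_(K-1). *)
    right => n /eqP; rewrite -subr_eq0 => /eqP H.
    pose n' i := if i == K then q.2 else - n i.
    suff : n' K = 0 by rewrite /n' eqxx => /eqP; rewrite (negbTE q0).
    apply: (zi K.+1 n') => //.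
    rewrite big_nat_recr//= {2}/n' eqxx addrC -[RHS]H -sumrN; congr (_ + _).
    apply: eq_big_nat => i /andP[_ iK].
    by rewrite /n' ltn_eqF// mulrNz mulNr.
  (* Otherwise w would be a combination involving z_K. *)
  right => n H; apply: (hw (fun i => if i == K then - q.2 else n i)).
  rewrite big_nat_recr//= eqxx mulrNz mulNr.
  apply/eqP; rewrite -subr_eq opprK H; apply/eqP.
  apply: eq_big_nat => i /andP[_ iK].
  by rewrite ltn_eqF.
have [bsum hsum] := has_mean_sum _ s _ _ bg hgl.
exists (fun t => \sum_(q <- s) g q t), (\sum_(q <- s) l q); split => //.
  move=> t; rewrite big_nat_recr//= addrA.
  have := hs (c + w * t + \sum_(0 <= i < K) b i * cos (th i + z i * t)) (th K + z K * t).
  rewrite /trig_sum; congr (`|_ - _| <= _).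
  by apply: eq_bigr => q _; rewrite /g; congr (_ * cos _); ring.
(* Only the constant harmonic contributes, as in a mean over the last phase. *)
have lE : \sum_(q <- s) l q = if w == 0 then
    circle_mean (trig_sum s c) * \prod_(0 <= i < K) J0 (b i) else 0.
  case: ifPn => [/eqP w0|w0].
    rewrite circle_mean_trig_sum mulr_suml; apply: eq_bigr => q _; rewrite /l w0 add0r.
    rewrite -mulrA; congr (_ * _); case: (eqVneq q.2 0) => [->|q0].
      by rewrite !mul0r eqxx addr0.
    rewrite ifF ?mul0r//; apply/negbTE; rewrite mulf_neq0 ?intr_eq0//.
    apply/eqP => zK; have := zi K.+1 (fun i => (i == K)%:Z) _ K (ltnSn _).
    rewrite eqxx => H; have : (1 : int) = 0; last by [].
    apply: H; rewrite big_nat_recr//= zK mulr0 addr0 big_nat big1// => i /andP[_ iK].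
    by rewrite ltn_eqF// mul0r.
  rewrite big1// => q _; rewrite /l ifF ?mulr0//; apply/negbTE/eqP => H.
  case: hw => [w0'|/(_ (fun i => if i == K then - q.2 else 0))]; first by rewrite w0' eqxx in w0.
  apply; rewrite big_nat_recr//= eqxx mulrNz mulNr big_nat big1 ?add0r.
    by apply/eqP; rewrite -subr_eq0 opprK; apply/eqP.
  by move=> i /andP[_ iK]; rewrite ltn_eqF// mul0r.
rewrite lE; case: ifPn => _; last by rewrite subrr normr0 ltW.
rewrite big_nat_recr//= (mulrC (\prod_(_ <= _ < _) _)) mulrA -mulrBl normrM.
rewrite -[leRHS]mulr1 ler_pM//.
  rewrite -circle_mean_cos_shift; apply: circle_mean_sup_le => //.
  - apply: bounded_measurable_cos => x; apply: cvgD; first exact: cvg_cst.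
    exact: continuous_mulcos.
  - exact: bounded_measurable_trig_sum.
elim: (K) => [|L ihL]; first by rewrite big_nil normr1.
by rewrite big_nat_recr//= normrM mulr_ile1// norm_J0_le1.
Qed.

End kronecker_weyl.

(** * Integrating out an independent variable *)

Section independence_tool.
Local Open Scope ereal_scope.
Context {d : measure_display} {Omega : measurableType d} {R : realType}.
Context {P : probability Omega R}.
Local Notation mu := (@lebesgue_measure R).

(** Independence of a class of events and a variable, to be used with a generated
    sigma-algebra; a pi-system is enough by [independent_of_pi_system]. *)
Definition independent_of (G : set (set Omega)) (Y : {RV P >-> R}) :=
  forall A B, G A -> measurable B -> P (A `&` Y @^-1` B) = P A * P (Y @^-1` B).

Lemma measurable_preimage (Y : {RV P >-> R}) (B : set R) : measurable B ->
  measurable (Y @^-1` B).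
Proof. by move=> mB; rewrite -[X in measurable X]setTI; exact: measurable_funP. Qed.

(** For fixed [B], both sides are finite measures of [A] that agree on a pi-system
    containing the whole space. *)
Lemma independent_of_pi_system (C : set (set Omega)) (Y : {RV P >-> R}) :
  C `<=` measurable -> setI_closed C -> C setT ->
  independent_of C Y -> independent_of <<s C>> Y.
Proof.
move=> Cm CI CT ind A B GA mB.
have mY := measurable_preimage Y B mB.
pose r : {nonneg R} := NngNum (fine_ge0 (measure_ge0 P (Y @^-1` B))).
have rE : (r%:num)%:E = P (Y @^-1` B) by rewrite fineK// fin_num_measure.
have /= := @g_sigma_algebra_measure_unique _ R Omega C Cm (fun=> setT) (fun=> CT) _
  (mrestr P mY) (mscale r P) CI _ _ A GA.
rewrite /mrestr /mscale /= rE (muleC (P A)); apply.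
- by apply/seteqP; split => // x _; exists 0%N.
- by move=> A' CA'; rewrite ind// muleC.
- by move=> _; rewrite -ge0_fin_numE// fin_num_measure//; exact: measurableI.
Qed.

Lemma generated_measurable (C : set (set Omega)) : C `<=` measurable ->
  <<s C>> `<=` measurable.
Proof. by move=> Cm; apply: smallest_sub => //; exact: sigma_algebra_measurable. Qed.

Lemma measurable_id_generated (C : set (set Omega)) : C `<=` measurable ->
  measurable_fun setT ((fun w => w) : Omega -> g_sigma_algebraType C).
Proof. by move=> Cm _ A mA; rewrite setTI; exact: (generated_measurable C Cm A mA). Qed.

(** Restricting [P] to the sub-sigma-algebra does not change the integrals of the
    functions measurable for it. *)
Lemma integral_generated (C : set (set Omega)) (Cm : C `<=` measurable)
    (f : g_sigma_algebraType C -> \bar R) : measurable_fun setT f ->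
  (forall w, 0 <= f w) ->
  let W : {RV P >-> g_sigma_algebraType C} :=
    HB.pack ((fun w => w) : Omega -> g_sigma_algebraType C)
     (isMeasurableFun.Build _ _ _ _ _ (measurable_id_generated C Cm)) in
  \int[distribution P W]_w f w = \int[P]_w f w.
Proof. by move=> mf f0 W; rewrite ge0_integral_distribution. Qed.

(** A variable independent of a sub-sigma-algebra can be integrated out first.
    The joint law of the identity, seen as a map into the sub-sigma-algebra, and
    of [Y] is a product measure. *)
Lemma integral_independent (C : set (set Omega)) (Y : {RV P >-> R})
    (F : g_sigma_algebraType C * R -> \bar R) :
  C `<=` measurable -> independent_of <<s C>> Y ->
  measurable_fun setT F -> (forall x, 0 <= F x) ->
  \int[P]_w F (w, Y w) = \int[P]_w \int[distribution P Y]_y F (w, y).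
Proof.
move=> Cm ind mF F0.
pose W : {RV P >-> g_sigma_algebraType C} :=
    HB.pack ((fun w => w) : Omega -> g_sigma_algebraType C)
     (isMeasurableFun.Build _ _ _ _ _ (measurable_id_generated C Cm)).
have mWY : measurable_fun setT (fun w => (W w, Y w)).
  by apply: measurable_fun_pair; exact: measurable_funP.
pose WY : {RV P >-> (g_sigma_algebraType C * R)%type} :=
  HB.pack (fun w => (W w, Y w)) (isMeasurableFun.Build _ _ _ _ _ mWY).
transitivity (\int[distribution P WY]_z F z); first by rewrite ge0_integral_distribution.
transitivity (\int[distribution P W \x distribution P Y]_z F z).
  apply: eq_measure_integral => A mA _; apply/esym.
  apply: (@product_measure_unique _ _ _ _ R (distribution P W) (distribution P Y)) => //.
rewrite fubini_tonelli1// integral_generated//.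
- exact: measurable_fun_fubini_tonelli_F.
- by move=> w; exact: integral_ge0.
Qed.

(** The two canonical measurable structures on the real line, the one carried
    by random variables and the one carried by Lebesgue measure, are matched by
    pushing forward along the identity. *)
Lemma integral_distribution_law (Y : {RV P >-> R})
    (nu : {measure set (measurableTypeR R) -> \bar R}) (f : R -> \bar R) :
  (forall B, measurable B -> distribution P Y B = nu B) ->
  measurable_fun setT f -> (forall x, 0 <= f x) ->
  \int[distribution P Y]_y f y = \int[nu]_y f y.
Proof.
move=> YE mf f0.
pose i : measurableTypeR R -> R := fun x => x.
have mi : measurable_fun setT i by exact: measurable_id.
have E := @ge0_integral_pushforward _ _ _ _ R i mi nu setT f measurableT mf (fun y _ => f0 y).
by apply: etrans E; apply: eq_measure_integral => A mA _; exact: YE.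
Qed.

Definition uniform_phase (Y : {RV P >-> R}) := forall B, measurable B ->
  distribution P Y B = uniform_prob (twopi_gt0 R) B.

Lemma integral_uniform_phase (Y : {RV P >-> R}) (f : R -> \bar R) : uniform_phase Y ->
  measurable_fun setT f -> (forall x, 0 <= f x) ->
  \int[distribution P Y]_y f y = ((2 * pi)^-1)%:E * \int[mu]_(x in `[0%R, (2 * pi)%R]) f x.
Proof.
move=> uY mf f0; transitivity (\int[uniform_prob (twopi_gt0 R)]_x f x).
  exact: (integral_distribution_law Y (uniform_prob (twopi_gt0 R))).
by rewrite integral_uniform// subr0.
Qed.

End independence_tool.

(** * Translation over a period *)

Section periodic_integral.
Local Open Scope ereal_scope.
Context {R : realType}.
Local Notation mu := (@lebesgue_measure R).
Implicit Types (f : R -> \bar R) (r s p : R).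

Lemma periodic_intE f p : (forall x, f (x + p)%R = f x) ->
  forall (n : int) x, f (x + n%:~R * p)%R = f x.
Proof.
move=> pf n.
have natE (k : nat) x : f (x + k%:R * p)%R = f x.
  elim: k => [|k ih]; first by rewrite mul0r addr0.
  by rewrite -natr1 mulrDl mul1r addrA pf ih.
case: n => n x; first exact: natE.
by rewrite NegzE mulrNz mulNr -[in RHS](subrK (n.+1%:R * p)%R x) natE.
Qed.

(** The part of [[r, p + r]] beyond [p] is moved back by one period. *)
Lemma ge0_integral_period_translate_lt f p r : measurable_fun setT f ->
  (forall x, 0 <= f x) -> (forall x, f (x + p)%R = f x) -> (0 <= r < p)%R ->
  \int[mu]_(x in `[0%R, p]) f (x + r)%R = \int[mu]_(x in `[0%R, p]) f x.
Proof.
move=> mf f0 pf /andP[r0 rp].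
have mfD D : measurable_fun D f by exact: measurable_funTS.
have mt (c : R) : measurable_fun setT (fun x : R => f (x + c)%R).
  by apply: measurableT_comp => //; apply: measurable_funD => //; exact: measurable_id.
rewrite -[LHS]integral_itv_bndo_bndc; last exact: measurable_funTS.
rewrite -[RHS]integral_itv_bndo_bndc//.
have -> : \int[mu]_(x in `[0%R, p[) f (x + r)%R = \int[mu]_(x in `[r, (p + r)%R[) f x.
  rewrite [RHS](@ge0_integral_translation R r)//; congr (integral _ _ _).
  by apply/seteqP; split => x/=; rewrite !in_itv/=; lra.
have -> : [set` `[r, (p + r)%R[] = [set` `[r, p[] `|` [set` `[p, (p + r)%R[] :> set R.
  by apply/seteqP; split => x/=; rewrite !in_itv/=; lra.
rewrite ge0_integral_setU//; do ?[exact: mfD |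
  by apply/disj_setPS => x/= []; rewrite !in_itv/=; lra].
have -> : [set` `[0%R, p[] = [set` `[0%R, r[] `|` [set` `[r, p[] :> set R.
  by apply/seteqP; split => x/=; rewrite !in_itv/=; lra.
rewrite [RHS]ge0_integral_setU//; do ?[exact: mfD |
  by apply/disj_setPS => x/= []; rewrite !in_itv/=; lra].
rewrite addeC; congr (_ + _).
rewrite [LHS](@ge0_integral_translation R p)//.
have -> : [set x : R | [set` `[p, (p + r)%R[] (x + p)%R] = [set` `[0%R, r[].
  by apply/seteqP; split => x/=; rewrite !in_itv/=; lra.
by apply: eq_integral => x _; rewrite pf.
Qed.

(** Translation by an arbitrary amount reduces to a translation by its remainder
    modulo the period. *)
Lemma ge0_integral_period_translate f p s : (0 < p)%R -> measurable_fun setT f ->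
  (forall x, 0 <= f x) -> (forall x, f (x + p)%R = f x) ->
  \int[mu]_(x in `[0%R, p]) f (x + s)%R = \int[mu]_(x in `[0%R, p]) f x.
Proof.
move=> p0 mf f0 pf.
pose n := Num.floor (s / p).
rewrite -[RHS](@ge0_integral_period_translate_lt f p (s - n%:~R * p)%R)//; last first.
  have /andP[h1 h2] : (n%:~R <= s / p < (n + 1)%:~R)%R by exact: floor_itv.
  rewrite subr_ge0 -ler_pdivlMr// h1/= ltrBlDl.
  by move: h2; rewrite ltr_pdivrMr// intrD mulrDl mul1r.
apply: eq_integral => x _.
rewrite -[in LHS](subrK (n%:~R * p)%R s) addrA periodic_intE//.
Qed.

End periodic_integral.

(** * Oscillations with uniform phases *)

Section oscillations.
Local Open Scope ereal_scope.
Context {d : measure_display} {Omega : measurableType d} {R : realType}.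
Context {P : probability Omega R}.
Local Notation mu := (@lebesgue_measure R).

Definition measurable_wrt (C : set (set Omega)) (f : Omega -> R) :=
  measurable_fun setT (f : g_sigma_algebraType C -> R).

Lemma measurable_wrtW (C : set (set Omega)) (f : Omega -> R) :
  C `<=` measurable -> measurable_wrt C f -> measurable_fun setT f.
Proof.
move=> Cm mf _ B mB; rewrite setTI; apply: (generated_measurable C Cm).
by have := mf measurableT B mB; rewrite setTI.
Qed.

(* The class C k determines all amplitudes, all frequencies and all phases except
   the k-th, which is uniform and independent of it. *)
Context (Th : nat -> {RV P >-> R}) (a z : nat -> Omega -> R).
Context (C : nat -> set (set Omega)).
Context (Cm : forall k, C k `<=` measurable).
Context (Cind : forall k, independent_of <<s C k>> (Th k)).
Context (Cunif : forall k, uniform_phase (Th k)).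
Context (Ca : forall i k, measurable_wrt (C k) (a i)).
Context (Cz : forall i k, measurable_wrt (C k) (z i)).
Context (CTh : forall i k, i <> k -> measurable_wrt (C k) (Th i)).

Definition measurable_phases (c : nat -> Omega -> R) :=
  forall i k, measurable_wrt (C k) (c i).

(** The additional phases [c] absorb translations of time: by [c i + z i],
    translating time by one becomes a change of phase. *)
Definition osc (c : nat -> Omega -> R) (n N : nat) (w : Omega) (t : R) : R :=
  (\sum_(n <= i < N) a i w * cos (Th i w + c i w + t * z i w))%R.

(** [osc] with its [k]-th phase made a free variable. *)
Definition osc_free (k : nat) (c : nat -> Omega -> R) (n N : nat)
    (p : g_sigma_algebraType (C k) * R * R) : R :=
  (\sum_(n <= i < N) a i p.1.1 *
     cos ((if i == k then p.1.2 else Th i p.1.1 + c i p.1.1) + p.2 * z i p.1.1))%R.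

Lemma measurable_cos_comp d' (E : measurableType d') (f : E -> R) :
  measurable_fun setT f -> measurable_fun setT (fun x => cos (f x)).
Proof.
move=> mf; apply: (@measurableT_comp _ _ _ _ _ _ (@cos R)) => //.
by apply: continuous_measurable_fun; exact: continuous_cos.
Qed.

Lemma measurable_osc_free k c n N : measurable_phases c ->
  measurable_fun setT (osc_free k c n N).
Proof.
move=> mc; apply: measurable_sum => i.
have m11 (f : Omega -> R) : measurable_wrt (C k) f ->
    measurable_fun setT (fun p : g_sigma_algebraType (C k) * R * R => f p.1.1).
  move=> mf; apply: (@measurableT_comp _ _ _ _ _ _ (f : g_sigma_algebraType (C k) -> R)) => //.
  by apply: measurableT_comp => //; exact: measurable_fst.
have m12 : measurable_fun setT (fun p : g_sigma_algebraType (C k) * R * R => p.1.2).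
  by apply: measurableT_comp; [exact: measurable_snd|exact: measurable_fst].
apply: measurable_funM; first exact: m11.
apply: measurable_cos_comp; apply: measurable_funD.
  case: eqP => [//|/eqP ik]; apply: measurable_funD; last exact: m11.
  by apply: m11; apply: CTh; apply/eqP.
by apply: measurable_funM; [exact: measurable_snd|exact: m11].
Qed.

Lemma osc_freeE k c n N w t :
  osc c n N w t = osc_free k c n N (w, (Th k w + c k w)%R, t).
Proof. by apply: eq_bigr => i _ /=; case: eqP => [->|]. Qed.

Lemma osc_free_periodic k c n N w (y t : R) :
  osc_free k c n N (w, (y + 2 * pi)%R, t) = osc_free k c n N (w, y, t).
Proof.
apply: eq_bigr => i _ /=; case: eqP => // _.
by rewrite addrAC (_ : (2 * pi = pi *+ 2)%R) ?cosD2pi// mulr_natl.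
Qed.

(** Functionals of a path for which equality in law can be tested without a
    sigma-algebra on the space of paths: it is enough that they be measurable
    along every jointly measurable family of paths. *)
Definition measurable_functional (Phi : (R -> R) -> \bar R) :=
  (forall f, 0 <= Phi f) /\
  forall (d' : measure_display) (E : measurableType d') (f : E * R -> R),
    measurable_fun setT f -> measurable_fun setT (fun e => Phi (fun t => f (e, t))).

(** The phase of a single oscillator may be translated by any amount that is
    independent of it. *)
Lemma osc_drop_phase k c n N Phi : measurable_functional Phi -> measurable_phases c ->
  \int[P]_w Phi (osc c n N w) =
  \int[P]_w Phi (osc (fun i => if i == k then (fun=> 0%R) else c i) n N w).
Proof.
move=> [Phi0 mPhi] mc.
pose F (p : g_sigma_algebraType (C k) * R) := Phi (fun t => osc_free k c n N (p, t)).
have mF : measurable_fun setT F by apply: mPhi; exact: measurable_osc_free.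
pose F' (p : g_sigma_algebraType (C k) * R) := F (p.1, p.2 + c k p.1)%R.
have mF' : measurable_fun setT F'.
  apply: measurableT_comp => //; apply: measurable_fun_pair; first exact: measurable_fst.
  apply: measurable_funD; first exact: measurable_snd.
  by apply: (@measurableT_comp _ _ _ _ _ _ (c k : g_sigma_algebraType (C k) -> R));
    [exact: mc|exact: measurable_fst].
transitivity (\int[P]_w F' (w, Th k w)).
  apply: eq_integral => w _; rewrite /F' /F /=; congr Phi.
  by apply/funext => t; rewrite -osc_freeE.
transitivity (\int[P]_w F (w, Th k w)); last first.
  apply: eq_integral => w _; rewrite /F /=; congr Phi.
  apply/funext => t; apply: eq_bigr => i _ /=; case: eqP => // ->.
  by rewrite addr0.
rewrite (integral_independent (C k) (Th k) F (Cm k) (Cind k) mF (fun p => Phi0 _)).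
rewrite (integral_independent (C k) (Th k) F' (Cm k) (Cind k) mF' (fun p => Phi0 _)).
apply: eq_integral => w _.
have m1 : measurable_fun setT (fun y : R => F (w, y)).
  exact: (@measurable_fun_pair2 _ _ _ (g_sigma_algebraType (C k)) R _ F w mF).
have m2 : measurable_fun setT (fun y : R => F' (w, y)).
  exact: (@measurable_fun_pair2 _ _ _ (g_sigma_algebraType (C k)) R _ F' w mF').
rewrite !integral_uniform_phase//; do ?by move=> p; exact: Phi0.
congr (_ * _).
apply: (@ge0_integral_period_translate R (fun y => F (w, y)) (2 * pi)%R (c k w)) => //.
- by rewrite mulr_gt0 ?pi_gt0.
- by move=> p; exact: Phi0.
- move=> x; rewrite /F; congr Phi; apply/funext => t.
  exact: osc_free_periodic.
Qed.

(** The phases are removed one at a time; the law of the oscillation as a path,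
    seen through [Phi], does not depend on them. *)
Lemma osc_phase_invariance c n N Phi : measurable_functional Phi -> measurable_phases c ->
  \int[P]_w Phi (osc c n N w) = \int[P]_w Phi (osc (fun _ _ => 0%R) n N w).
Proof.
move=> mPhi mc.
pose cj j := fun i => if (i < j)%N then (fun _ : Omega => 0%R) else c i.
have mcj j : measurable_phases (cj j).
  by move=> i k; rewrite /cj; case: ifP => _; [exact: measurable_cst|exact: mc].
transitivity (\int[P]_w Phi (osc (cj N) n N w)); last first.
  apply: eq_integral => w _; congr Phi; apply/funext => t.
  by apply: eq_big_nat => i /andP[_ iN]; rewrite /cj iN.
elim: (X in cj X) => [|j ih]; first by [].
rewrite ih (osc_drop_phase j _ _ _ _ mPhi (mcj j)).
apply: eq_integral => w _; congr Phi; apply/funext => t.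
apply: eq_big_nat => i _; rewrite /cj ltnS [(i <= j)%N]leq_eqVlt.
by case: eqP.
Qed.

Lemma measurable_osc c n N : measurable_phases c ->
  measurable_fun setT (fun p : Omega * R => osc c n N p.1 p.2).
Proof.
move=> mc; apply: measurable_sum => i.
have m1 (f : Omega -> R) : measurable_wrt (C 0%N) f ->
    measurable_fun setT (fun p : Omega * R => f p.1).
  move=> /(measurable_wrtW _ _ (Cm 0%N)) mf.
  by apply: measurableT_comp => //; exact: measurable_fst.
apply: measurable_funM; first exact: m1.
apply: measurable_cos_comp; apply: measurable_funD.
  apply: measurable_funD; last exact: m1.
  by apply: measurableT_comp; [exact: measurable_funP|exact: measurable_fst].
by apply: measurable_funM; [exact: measurable_snd|exact: m1].
Qed.

Lemma phase_average_trig (K A B s s' : R) : ((2 * pi)^-1 *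
  Rintegral mu `[0%R, (2 * pi)%R]
    (fun y => K + (A * cos (s + 1 * y) + B * cos (s' + 2 * y))) = K)%R.
Proof.
have p0 : (0 < 2 * pi :> R)%R by rewrite mulr_gt0 ?pi_gt0.
have bm1 : bounded_measurable (fun y : R => cos (s + 1 * y))%R.
  by apply: bounded_measurable_cos; exact: continuous_affine.
have bm2 : bounded_measurable (fun y : R => cos (s' + 2 * y))%R.
  by apply: bounded_measurable_cos; exact: continuous_affine.
have bK := bounded_measurable_cst K.
rewrite RintegralD//=; do ?by do ?[apply: bounded_measurable_integrable |
  apply: bounded_measurableD | apply: bounded_measurableZ].
rewrite RintegralD//=; do ?by do ?[apply: bounded_measurable_integrable |
  apply: bounded_measurableZ].
rewrite !RintegralZl//=; do ?by apply: bounded_measurable_integrable.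
have n2 : (2 != 0 :> R)%R by rewrite pnatr_eq0.
rewrite Rintegral_itv_cst ?ltW// (Rintegral_cos_linear _ _ _ _ (ltW p0) (oner_neq0 _)).
rewrite (Rintegral_cos_linear _ _ _ _ (ltW p0) n2).
rewrite mul1r !mulr0 !addr0 mulr_natl sinD2pi.
rewrite (_ : s' + 2 * (pi *+ 2) = s' + pi *+ 2 + pi *+ 2)%R; last by ring.
by rewrite !sinD2pi !subrr !mulr0 !addr0 subr0 -mulr_natl mulrC mulfK ?gt_eqF.
Qed.

(** Averaging over one phase makes its oscillation orthogonal to the rest, of
    value [x], and gives it the mean square [b ^ 2 / 2]. *)
Lemma phase_average_sqr (x b s : R) :
  ((2 * pi)^-1)%:E * \int[mu]_(y in `[0%R, (2 * pi)%R]) (((x + b * cos (y + s)) ^+ 2)%R)%:E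
  = (x ^+ 2 + b ^+ 2 / 2)%:E.
Proof.
pose g (y : R) : R := (x ^+ 2 + b ^+ 2 / 2 + (2 * x * b * cos (s + 1 * y)
   + b ^+ 2 / 2 * cos (2 * s + 2 * y)))%R.
have gE (y : R) : ((x + b * cos (y + s)) ^+ 2 = g y)%R.
  rewrite /g (_ : 2 * s + 2 * y = (y + s) *+ 2)%R; last by ring.
  by rewrite mul1r (addrC s) cos_mulr2n; field.
under eq_integral do rewrite gE.
have bm : bounded_measurable g.
  apply: bounded_measurableD; first exact: bounded_measurable_cst.
  by apply: bounded_measurableD; apply: bounded_measurableZ;
    apply: bounded_measurable_cos; exact: continuous_affine.
have ig := bounded_measurable_integrable _ 0%R (2 * pi)%R bm.
rewrite -[X in _ * X]fineK; last exact: (integrable_fin_num _ ig).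
by rewrite -EFinM; congr EFin; exact: phase_average_trig.
Qed.

(** The terms are orthogonal, each with the mean square of a cosine; by induction
    on [N], integrating out the last phase first. *)
Lemma second_moment_osc c n N t : measurable_phases c -> (n <= N)%N ->
  \int[P]_w ((osc c n N w t) ^+ 2)%:E =
  \sum_(n <= i < N) (2^-1)%:E * \int[P]_w ((a i w) ^+ 2)%:E.
Proof.
move=> mc; elim: N => [|N ih].
  rewrite leqn0 => /eqP ->; rewrite big_nil.
  by apply: integral0_eq => w _; rewrite /osc big_nil expr0n.
rewrite leq_eqVlt => /predU1P[->|nN].
  rewrite big_geq//.
  by apply: integral0_eq => w _; rewrite /osc big_geq// expr0n.
rewrite ltnS in nN.
rewrite big_nat_recr//= -ih//.
have ma i : measurable_fun setT (a i) by exact: measurable_wrtW (Ca i 0%N).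
have mo : measurable_fun setT (fun w => osc c n N w t).
  exact: (measurable_fun_pair1 t (measurable_osc c n N mc)).
rewrite -ge0_integralZl//; last 2 first.
- by apply/measurable_EFinP; exact: measurable_funX.
- by move=> w _; rewrite lee_fin sqr_ge0.
rewrite -ge0_integralD//; last 4 first.
- by move=> w _; rewrite lee_fin sqr_ge0.
- by apply/measurable_EFinP; exact: measurable_funX.
- by move=> w _; rewrite -EFinM lee_fin mulr_ge0 ?invr_ge0// sqr_ge0.
- apply: emeasurable_funM; first exact: measurable_cst.
  by apply/measurable_EFinP; exact: measurable_funX.
pose F (p : g_sigma_algebraType (C N) * R) := ((osc_free N c n N.+1 (p.1, (p.2 + c N p.1)%R, t)) ^+ 2)%:E.
have mF : measurable_fun setT F.
  apply/measurable_EFinP; apply: measurable_funX.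
  apply: (@measurableT_comp _ _ _ _ _ _ (osc_free N c n N.+1)); first exact: measurable_osc_free.
  apply: measurable_fun_pair; last exact: measurable_cst.
  apply: measurable_fun_pair; first exact: measurable_fst.
  apply: measurable_funD; first exact: measurable_snd.
  by apply: (@measurableT_comp _ _ _ _ _ _ (c N : g_sigma_algebraType (C N) -> R));
    [exact: mc|exact: measurable_fst].
transitivity (\int[P]_w F (w, Th N w)).
  by apply: eq_integral => w _; rewrite /F /= -osc_freeE.
have F0 p : 0 <= F p by rewrite lee_fin sqr_ge0.
rewrite (integral_independent (C N) (Th N) F (Cm N) (Cind N) mF F0).
apply: eq_integral => w _.
rewrite integral_uniform_phase//; last first.
  exact: (@measurable_fun_pair2 _ _ _ (g_sigma_algebraType (C N)) R _ F w mF).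
rewrite -EFinM -EFinD (mulrC 2^-1)%R -(phase_average_sqr _ _ (c N w + t * z N w)); congr (_ * _).
apply: eq_integral => y _; rewrite /F /osc_free /= big_nat_recr//= eqxx addrA.
congr ((_ + _) ^+ 2)%:E; rewrite /osc.
by apply: eq_big_nat => i /andP[_ iN]; rewrite ltn_eqF.
Qed.

End oscillations.

(** * The maximal ergodic inequality *)

Section maximal_inequality.
Local Open Scope ereal_scope.
Context {R : realType}.
Local Notation mu := (@lebesgue_measure R).

(** The indicator inside the integrand puts the integral on the whole line, as
    Fubini's theorem on a product of whole spaces requires. *)
Definition energy (f : R -> R) : \bar R :=
  \int[mu]_t ((f t) ^+ 2 * \1_(`[0%R, 1%R]%classic : set R) t)%:E.

Definition shift1 (f : R -> R) : R -> R := fun t => f (t + 1)%R.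

(** The maximum over [0 <= l <= L] of the sum of the energies of the first [l]
    unit translates, minus [l e]; it is positive when the average energy over some
    initial interval exceeds [e]. The recursion is what Garsia's argument uses. *)
Fixpoint excess (e : R) (L : nat) (f : R -> R) : \bar R :=
  if L is L'.+1 then maxe 0 (energy f + excess e L' (shift1 f) - e%:E) else 0.

Arguments energy : simpl never.
Arguments excess : simpl never.

Lemma excessS e L f :
  excess e L.+1 f = maxe 0 (energy f + excess e L (shift1 f) - e%:E).
Proof. by []. Qed.

Lemma energy_ge0 f : 0 <= energy f.
Proof. by apply: integral_ge0 => t _; rewrite lee_fin mulr_ge0 ?sqr_ge0. Qed.

Lemma excess_ge0 e L f : 0 <= excess e L f.
Proof. by case: L => [|L]; [exact: lexx|rewrite excessS le_max lexx]. Qed.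

Lemma le_excessS e L f : excess e L f <= excess e L.+1 f.
Proof.
elim: L f => [|L ih] f; first exact: excess_ge0.
rewrite !excessS ge_max le_max lexx/= le_max; apply/orP; right.
by rewrite leeD// leeD2l// -excessS; exact: ih.
Qed.

(** The pointwise inequality behind the maximal inequality: when the maximum is
    positive it is attained for some [l > 0], and removing the first unit interval
    costs [energy f - e]. *)
Lemma excess_step (e : R) L f :
  excess e L f + (if 0 < excess e L f then e%:E else 0) <= excess e L (shift1 f) + energy f.
Proof.
case: L => [|L].
  by rewrite -[excess e 0 _]/0 ltxx adde0 adde_ge0// energy_ge0.
rewrite {1 2}excessS; set q := energy f + _ - _.
have [q0|q0] := ltP 0 q.
  by rewrite q0 subeK// addeC leeD2r// le_excessS.
by rewrite ltxx adde0 adde_ge0 ?energy_ge0 ?excess_ge0.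
Qed.

Lemma sum_energy_le (e : R) (l L : nat) f : (l <= L)%N ->
  \sum_(0 <= i < l) energy (iter i shift1 f) <= (l%:R * e)%:E + excess e L f.
Proof.
elim: l L f => [|l ih] L f.
  by rewrite big_nil mul0r add0e excess_ge0.
case: L => [//|L]; rewrite ltnS => lL.
rewrite big_nat_recl//.
rewrite (eq_bigr (fun i => energy (iter i shift1 (shift1 f)))); last first.
  by move=> i _; rewrite iterSr.
have h : energy f + excess e L (shift1 f) <= e%:E + excess e L.+1 f.
  by rewrite -leeBlDl// excessS le_max lexx orbT.
rewrite -natr1 mulrDl mul1r EFinD -[leRHS]addeA.
rewrite (@le_trans _ _ (energy f + ((l%:R * e)%:E + excess e L (shift1 f))))//.
  by rewrite leeD2l// ih.
by rewrite (addeCA (energy f)) leeD2l.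
Qed.

Lemma measurable_functional_shift1 Phi : measurable_functional Phi ->
  measurable_functional (fun f : R -> R => Phi (shift1 f)).
Proof.
move=> [Phi0 mPhi]; split => [f|d' E f mf]; first exact: Phi0.
apply: (mPhi _ _ (fun p : E * R => f (p.1, (p.2 + 1)%R))).
apply: measurableT_comp => //; apply: measurable_fun_pair; first exact: measurable_fst.
by apply: measurable_funD => //; exact: measurable_snd.
Qed.

Lemma measurable_functional_energy : measurable_functional energy.
Proof.
split=> [f|d' E f mf]; first exact: energy_ge0.
apply: (@measurable_fun_fubini_tonelli_F _ _ E _ R mu
  (fun p : E * R => ((f p) ^+ 2 * \1_(`[0%R, 1%R]%classic : set R) p.2)%:E)) => //.
- apply/measurable_EFinP; apply: measurable_funM; first exact: measurable_funX.
  by apply: measurableT_comp; [exact: measurable_indic|exact: measurable_snd].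
- by move=> p; rewrite lee_fin mulr_ge0 ?sqr_ge0.
Qed.

Lemma measurable_functional_excess (e : R) L : measurable_functional (excess e L).
Proof.
elim: L => [|L ih]; first by split => [f|d' E f mf] //=; exact: measurable_cst.
split => [f|d' E f mf]; first exact: excess_ge0.
apply: measurable_maxe; first exact: measurable_cst.
apply: emeasurable_funB; last exact: measurable_cst.
apply: emeasurable_funD; first exact: (measurable_functional_energy.2).
exact: (measurable_functional_shift1 _ ih).2.
Qed.

Context {d : measure_display} {Omega : measurableType d} {P : probability Omega R}.

(** Garsia's argument: integrate [excess_step]; by stationarity the integrals of
    the two excesses are equal and, being finite, cancel. *)
Lemma maximal_inequality (S : Omega -> R -> R) (e : R) (L : nat) :
  measurable_fun setT (fun p : Omega * R => S p.1 p.2) ->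
  (forall Phi, measurable_functional Phi ->
    \int[P]_w Phi (shift1 (S w)) = \int[P]_w Phi (S w)) ->
  (0 < e)%R -> \int[P]_w energy (S w) < +oo ->
  e%:E * P [set w | 0 < excess e L (S w)] <= \int[P]_w energy (S w).
Proof.
move=> mS stat e0 Efin.
have mPhi (Phi : (R -> R) -> \bar R) : measurable_functional Phi ->
  measurable_fun setT (fun w => Phi (S w)) by case=> _ H; exact: (H _ Omega (fun p => S p.1 p.2) mS).
have mE := mPhi _ measurable_functional_energy.
have mX L' := mPhi _ (measurable_functional_excess e L').
have mX1 L' := mPhi _ (measurable_functional_shift1 _ (measurable_functional_excess e L')).
have xfin L' : \int[P]_w excess e L' (S w) < +oo.
  elim: L' => [|L' ih]; first by rewrite integral0.
  apply: (@le_lt_trans _ _ (\int[P]_w (energy (S w) + excess e L' (shift1 (S w))))).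
    apply: ge0_le_integral => //.
    - by move=> w _; exact: excess_ge0.
    - exact: emeasurable_funD.
    - move=> w _; rewrite excessS ge_max adde_ge0 ?energy_ge0 ?excess_ge0//=.
      by rewrite geeDl// lee_fin oppr_le0 ltW.
  rewrite ge0_integralD//; last 2 first.
  - by move=> w _; exact: energy_ge0.
  - by move=> w _; exact: excess_ge0.
  by rewrite lte_add_pinfty// stat//; exact: measurable_functional_excess.
pose B := [set w | 0 < excess e L (S w)].
have mB : measurable B.
  have := emeasurable_fun_o_infty measurableT (mX L) 0.
  by rewrite setTI.
have key : \int[P]_w (excess e L (S w) + (e%:E * (\1_B w)%:E)) <=
    \int[P]_w (excess e L (shift1 (S w)) + energy (S w)).
  apply: ge0_le_integral => //.
  - by move=> w _; rewrite adde_ge0 ?excess_ge0// -EFinM lee_fin mulr_ge0// ltW.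
  - apply: emeasurable_funD => //; apply: emeasurable_funM; first exact: measurable_cst.
    by apply/measurable_EFinP; exact: measurable_indic.
  - exact: emeasurable_funD.
  - move=> w _; apply: le_trans (excess_step e L (S w)).
    rewrite leeD2l// indicE; case: (boolP (w \in B)) => wB.
      by rewrite mule1 ifT//; exact: (set_mem wB).
    by rewrite mule0; case: ifP => // _; rewrite lee_fin ltW.
move: key; rewrite ge0_integralD//; last 3 first.
- by move=> w _; exact: excess_ge0.
- by move=> w _; rewrite -EFinM lee_fin mulr_ge0// ltW.
- apply: emeasurable_funM; first exact: measurable_cst.
  by apply/measurable_EFinP; exact: measurable_indic.
rewrite [leRHS]ge0_integralD//; last 2 first.
- by move=> w _; exact: excess_ge0.
- by move=> w _; exact: energy_ge0.
rewrite stat; last exact: measurable_functional_excess.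
rewrite leeD2lE; last first.
  by rewrite ge0_fin_numE ?xfin// integral_ge0// => w _; exact: excess_ge0.
rewrite ge0_integralZl//; last 2 first.
- by apply/measurable_EFinP; exact: measurable_indic.
- by rewrite lee_fin ltW.
by rewrite integral_indic// setIT.
Qed.

Lemma energy_shiftE (f : R -> R) (i : nat) : measurable_fun setT f ->
  energy (iter i shift1 f) = \int[mu]_(t in `[i%:R, i.+1%:R]) ((f t) ^+ 2)%:E.
Proof.
move=> mf; have -> : iter i shift1 f = (fun t => f (t + i%:R)%R).
  elim: i f {mf} => [|i ih] f; first by apply/funext => t; rewrite addr0.
  by rewrite iterSr ih; apply/funext => t; rewrite /shift1 -natr1 addrA.
rewrite (@ge0_integral_translation R i%:R)//; last 2 first.
- by apply/measurable_EFinP; exact: measurable_funX.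
- by move=> x; rewrite lee_fin sqr_ge0.
rewrite /energy [RHS]integral_mkcond.
apply: eq_integral => t _; rewrite patchE indicE.
have -> : (t \in [set x : R | [set` `[i%:R, i.+1%:R]] (x + i%:R)%R]) = (t \in (`[0%R, 1%R]%classic : set R)).
  apply/idP/idP; rewrite !inE/= !in_itv/= -natr1; lra.
by case: ifP => _; rewrite ?mulr1// mulr0.
Qed.

Lemma integral_sqr_le_energy (f : R -> R) (l : nat) : measurable_fun setT f ->
  \int[mu]_(t in `[0%R, l%:R]) ((f t) ^+ 2)%:E <= \sum_(0 <= i < l) energy (iter i shift1 f).
Proof.
move=> mf; have f0 (t : R) : 0 <= ((f t) ^+ 2)%:E by rewrite lee_fin sqr_ge0.
have mf2 : measurable_fun setT (fun t : R => ((f t) ^+ 2)%:E).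
  by apply/measurable_EFinP; exact: measurable_funX.
elim: l => [|l ih]; first by rewrite set_itv1 integral_set1 big_nil.
rewrite big_nat_recr//= energy_shiftE//.
have -> : [set` `[0%R, l.+1%:R]] = [set` `[0%R, l%:R]] `|` [set` `]l%:R, l.+1%:R]] :> set R.
  have := ler0n R l; rewrite -natr1 => l0.
  by apply/seteqP; split => x/=; rewrite !in_itv/=; lra.
rewrite ge0_integral_setU//; last 2 first.
- exact: measurable_funTS.
- by apply/disj_setPS => x/= []; rewrite !in_itv/=; lra.
rewrite leeD// ge0_subset_integral//; first exact: measurable_funTS.
by move=> x; rewrite /= !in_itv/= => /andP[/ltW -> ->].
Qed.

End maximal_inequality.

(** * Tails of oscillation series *)

Section oscillation_tails.
Local Open Scope ereal_scope.
Context {d : measure_display} {Omega : measurableType d} {R : realType}.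
Context {P : probability Omega R}.
Local Notation mu := (@lebesgue_measure R).
Context (Th : nat -> {RV P >-> R}) (a z : nat -> Omega -> R).
Context (C : nat -> set (set Omega)).
Context (Cm : forall k, C k `<=` measurable).
Context (Cind : forall k, independent_of <<s C k>> (Th k)).
Context (Cunif : forall k, uniform_phase (Th k)).
Context (Ca : forall i k, measurable_wrt (C k) (a i)).
Context (Cz : forall i k, measurable_wrt (C k) (z i)).
Context (CTh : forall i k, i <> k -> measurable_wrt (C k) (Th i)).
Context (c : nat -> Omega -> R) (mc : measurable_phases C c).
Context (rho : nat -> R).
Context (a_rho : forall n N, (n <= N)%N ->
  \sum_(n <= i < N) (2^-1)%:E * \int[P]_w ((a i w) ^+ 2)%:E <= (rho n)%:E).
Context (rho0 : rho n @[n --> \oo] --> 0%R).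

(* Partial tails, from the index n to N; rho bounds their mean squares. *)
Local Notation S := (osc Th a z c).

Lemma measurable_tail n N : measurable_fun setT (fun p : Omega * R => S n N p.1 p.2).
Proof. exact: measurable_osc. Qed.

(** Translating time by one adds the frequencies to the phases. *)
Lemma stationary_tail n N Phi : measurable_functional Phi ->
  \int[P]_w Phi (shift1 (S n N w)) = \int[P]_w Phi (S n N w).
Proof.
move=> mPhi; pose c1 i w := (c i w + z i w)%R.
have mc1 : measurable_phases C c1 by move=> i k; apply: measurable_funD; [exact: mc|exact: Cz].
transitivity (\int[P]_w Phi (osc Th a z c1 n N w)).
  apply: eq_integral => w _; congr Phi; apply/funext => t.
  by apply: eq_bigr => i _; rewrite /c1; congr (_ * cos _)%R; ring.
by rewrite !(osc_phase_invariance _ _ _ _ Cm Cind Cunif Ca Cz CTh).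
Qed.

Lemma integral_energy_tail_le n N : (n <= N)%N ->
  \int[P]_w energy (S n N w) <= (rho n)%:E.
Proof.
move=> nN; rewrite /energy.
pose g (p : Omega * R) := ((S n N p.1 p.2) ^+ 2 * \1_(`[0%R, 1%R]%classic : set R) p.2)%:E.
have mg : measurable_fun setT g.
  apply/measurable_EFinP; apply: measurable_funM.
    by apply: measurable_funX; exact: measurable_tail.
  by apply: measurableT_comp; [exact: measurable_indic|exact: measurable_snd].
have g0 p : 0 <= g p by rewrite lee_fin mulr_ge0 ?sqr_ge0.
rewrite (@fubini_tonelli _ _ Omega _ R P mu g mg g0).
have mS t : measurable_fun setT (fun w => S n N w t).
  exact: (measurable_fun_pair1 t (measurable_tail n N)).
set K := \sum_(n <= i < N) (2^-1)%:E * \int[P]_w ((a i w) ^+ 2)%:E.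
have K0 : 0 <= K.
  apply: sume_ge0 => i _; rewrite mule_ge0 ?lee_fin ?invr_ge0//.
  by apply: integral_ge0 => w _; rewrite lee_fin sqr_ge0.
have -> : \int[mu]_t \int[P]_w g (w, t) =
    \int[mu]_t ((\1_(`[0%R, 1%R]%classic : set R) t)%:E * K).
  apply: eq_integral => t _; rewrite /g /=.
  under eq_integral do rewrite EFinM muleC.
  rewrite ge0_integralZl//; last 2 first.
  - by apply/measurable_EFinP; exact: measurable_funX.
  - by move=> w _; rewrite lee_fin sqr_ge0.
  by rewrite (second_moment_osc _ _ _ _ Cm Cind Cunif Ca Cz CTh _ _ _ _ mc nN).
rewrite ge0_integralZr//; last by apply/measurable_EFinP; exact: measurable_indic.
rewrite integral_indic// setIT.
rewrite /= lebesgue_measure_itv/= lte_fin ltr01 -EFinB subr0 mul1e.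
exact: a_rho.
Qed.

(* One index N serves both as the end of the partial tail and as the time horizon,
   so that every fixed horizon is covered for N large. *)
Local Notation K e n N := [set w | 0 < excess e N (S n N w)].

Lemma measurable_excess_event (e : R) n N : measurable (K e n N).
Proof.
have mX : measurable_fun setT (fun w => excess e N (S n N w)).
  exact: ((measurable_functional_excess e N).2 _ Omega _ (measurable_tail n N)).
by have := emeasurable_fun_o_infty measurableT mX 0; rewrite setTI.
Qed.

Lemma prob_excess_tail_le (e : R) n N : (0 < e)%R -> (n <= N)%N ->
  P (K e n N) <= (rho n / e)%:E.
Proof.
move=> e0 nN.
have E := integral_energy_tail_le n N nN.
have := maximal_inequality (S n N) e N (measurable_tail n N) (stationary_tail n N) e0
  (le_lt_trans E (ltry _)).
move=> /le_trans/(_ E) H.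
by rewrite EFinM lee_pdivlMr// muleC.
Qed.

(** The events [K e n N] are not monotone in [N]; but that they hold for all large
    [N] has probability at most their common bound. Outside this event, infinitely many
    partial tails starting at [n] are small in mean square. *)
Lemma prob_ultimately_excess_le (e : R) n : (0 < e)%R ->
  P (\bigcup_N0 \bigcap_(N in [set N | (N0 <= N)%N]) K e n N) <= (rho n / e)%:E.
Proof.
move=> e0; set G := fun N0 => \bigcap_(N in [set N | (N0 <= N)%N]) K e n N.
have mG N0 : measurable (G N0).
  by apply: bigcap_measurableType => N _; exact: measurable_excess_event.
have mUG : measurable (\bigcup_N0 G N0) by exact: bigcup_measurable.
have ndG : nondecreasing_seq G.
  move=> i j ij; apply/subsetPset => w Gw N /= jN; apply: Gw => /=.
  exact: leq_trans jN.
have cv := nondecreasing_cvg_mu mG mUG ndG (mu := P).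
have := cvg_lim (@ereal_hausdorff R) cv => <-.
apply: lime_le; first by apply/cvg_ex; eexists; exact: cv.
near=> N0.
apply: le_trans (prob_excess_tail_le e n (maxn n N0) e0 (leq_maxl _ _)).
apply: le_measure; rewrite ?inE//; first exact: measurable_excess_event.
by move=> w; apply => /=; exact: leq_maxr.
Unshelve. all: by end_near. Qed.

(** Since [rho n] tends to zero, almost surely the exceptional event of
    [prob_ultimately_excess_le] fails for arbitrarily large [n]. *)
Lemma tail_small_ae : {ae P, forall w, forall q m : nat, exists n, (m <= n)%N /\
  forall N0, exists N, (N0 <= N)%N /\ forall l, (l <= N)%N ->
    \int[mu]_(t in `[0%R, l%:R]) ((S n N w t) ^+ 2)%:E <= (l%:R * (q.+1%:R)^-1)%:E}.
Proof.
apply/ae_foralln => q; apply/ae_foralln => m.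
pose e : R := (q.+1%:R)^-1%R.
have e0 : (0 < e)%R by rewrite invr_gt0.
pose H n := \bigcup_N0 \bigcap_(N in [set N | (N0 <= N)%N]) K e n N.
have mH n : measurable (H n).
  by apply: bigcup_measurable => N0 _; apply: bigcap_measurableType => N _; exact: measurable_excess_event.
exists (\bigcap_(n in [set n | (m <= n)%N]) H n); split.
- exact: bigcap_measurableType.
- apply/eqP; rewrite eq_le measure_ge0 andbT.
  have cv : (rho n / e)%:E @[n --> \oo] --> (0 / e)%:E.
    by apply: cvg_EFin; [near=> n|apply: cvgMl; exact: rho0].
  rewrite mul0r in cv.
  rewrite -[leRHS]/(0%R%:E) -(cvg_lim (@ereal_hausdorff R) cv).
  apply: lime_ge; first by apply/cvg_ex; eexists; exact: cv.
  near=> n.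
  apply: le_trans (prob_ultimately_excess_le e n e0).
  apply: le_measure; rewrite ?inE.
  - exact: bigcap_measurableType.
  - exact: mH.
  - by move=> w; apply => /=; near: n; exact: nbhs_infty_ge.
move=> w /= nw n mn; apply: contrapT => nH; apply: nw; exists n; split => // N0.
apply: contrapT => nN; apply: nH; exists N0 => // N /= N0N.
rewrite ltNge; apply/negP => ex0; apply: nN; exists N; split => // l lN.
apply: le_trans (integral_sqr_le_energy _ _ _) _.
  exact: (measurable_fun_pair2 w (measurable_tail n N)).
apply: le_trans (sum_energy_le e l N _ lN) _.
by rewrite -[leRHS]adde0 leeD2l.
Unshelve. all: by end_near. Qed.

End oscillation_tails.

(** * The deterministic limit *)

Section pathwise.
Context {R : realType}.
Local Notation mu := (@lebesgue_measure R).

Lemma limn_einf_le_frequently (u : (\bar R)^nat) (b : \bar R) :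
  (forall N0, exists N, (N0 <= N)%N /\ (u N <= b)%E) -> (limn_einf u <= b)%E.
Proof.
move=> H; rewrite limn_einf_lim; apply: lime_le; first exact: is_cvg_einfs.
apply: nearW => N0; have [N [N0N uN]] := H N0.
by apply: ge_ereal_inf; exists (u N) => //; exists N.
Qed.

Context (a th z : nat -> R) (D : R -> R).

Definition partial_osc (n N : nat) (t : R) : R :=
  \sum_(n <= i < N) a i * cos (th i + z i * t).

Lemma continuous_partial_osc n N : continuous (partial_osc n N).
Proof.
move=> x; rewrite /partial_osc.
elim: (index_iota n N) => [|i s ih].
  rewrite (_ : (fun t => _) = (fun=> 0)); first exact: cvg_cst.
  by apply/funext => t; rewrite big_nil.
rewrite (_ : (fun t => _) = (fun t => a i * cos (th i + z i * t) +
  \sum_(i <- s) a i * cos (th i + z i * t))); last by apply/funext => t; rewrite big_cons.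
apply: cvgD => //; apply: cvgM; first exact: cvg_cst.
exact: (continuous_cos_comp _ (continuous_affine _ _)).
Qed.

Lemma measurable_partial_osc n N : measurable_fun setT (partial_osc n N).
Proof. by apply: continuous_measurable_fun; exact: continuous_partial_osc. Qed.

Context (mD : measurable_fun setT D).
Context (xD : {ae mu, forall t, partial_osc 0 N t @[N --> \oo] --> D t}).

(** Fatou's lemma in [N]: a bound that holds for infinitely many partial tails is
    inherited by the full tail. *)
Lemma integral_sqr_tail_le n (l : nat) (b : \bar R) :
  (forall N0, exists N, (N0 <= N)%N /\
    (\int[mu]_(t in `[0%R, l%:R]) ((partial_osc n N t) ^+ 2)%:E <= b)%E) ->
  (\int[mu]_(t in `[0%R, l%:R]) ((D t - partial_osc 0 n t) ^+ 2)%:E <= b)%E.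
Proof.
move=> H.
have mf N : measurable_fun setT (fun t => ((partial_osc n N t) ^+ 2)%:E).
  by apply/measurable_EFinP; apply: measurable_funX; exact: measurable_partial_osc.
pose g t := limn_einf (fun N => ((partial_osc n N t) ^+ 2)%:E).
have mg : measurable_fun setT g.
  rewrite (_ : g = (fun t => - limn_esup (fun N => - ((partial_osc n N t) ^+ 2)%:E)))%E.
    apply: measurableT_comp => //; apply: (@measurable_fun_limn_esup _ _ _ setT
      (fun N t => (- ((partial_osc n N t) ^+ 2)%:E))%E) => N.
    exact: measurableT_comp.
  by [].
have g0 t : (0 <= g t)%E.
  rewrite /g limn_einf_lim; apply: lime_ge; first exact: is_cvg_einfs.
  apply: nearW => N; apply: le_ereal_inf_tmp => _ [k _ <-].
  by rewrite lee_fin sqr_ge0.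
have mDx : measurable_fun setT (fun t => D t - partial_osc 0 n t).
  by apply: measurable_funB => //; exact: measurable_partial_osc.
apply: (@le_trans _ _ (\int[mu]_(t in `[0%R, l%:R]) g t)%E).
  apply: ae_ge0_le_integral => //.
  - by move=> t _; rewrite lee_fin sqr_ge0.
  - by apply: measurable_funTS; apply/measurable_EFinP; exact: measurable_funX.
  - exact: measurable_funTS.
  apply: negligibleS xD => t /= nt xt; apply: nt => _.
  have cv : ((partial_osc n N t) ^+ 2)%:E @[N --> \oo] --> ((D t - partial_osc 0 n t) ^+ 2)%:E.
    apply: cvg_EFin; first by apply: nearW.
    have cvd : ((partial_osc 0 N t - partial_osc 0 n t) ^+ 2) @[N --> \oo]
        --> (D t - partial_osc 0 n t) ^+ 2.
      by rewrite expr2; under eq_fun do rewrite expr2;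
        apply: cvgM; apply: cvgB => //; exact: cvg_cst.
    apply: cvg_trans cvd; apply: near_eq_cvg; near=> N.
    rewrite /partial_osc [in X in X - _](@big_cat_nat _ _ _ n)//=.
      by rewrite addrAC subrr add0r.
    by near: N; exact: nbhs_infty_ge.
  by rewrite /g (cvg_limn_einf_sup cv).1.
apply: (le_trans (fatou _ _ _ _)) => //.
- by move=> N; apply: measurable_funTS; exact: mf.
- by move=> N t _; rewrite lee_fin sqr_ge0.
exact: limn_einf_le_frequently.
Unshelve. all: by end_near. Qed.

(** A phase functional of [D] is averaged, up to a small error, like that of a
    partial sum whose tail has small mean square; the constant comes from
    [|u| <= e + u ^ 2 / e], and the factor 2 from rounding [T] up to an integer,
    at most [2 T]. *)
Lemma time_mean_tail_le (phi : R -> R) (lambda e b : R) n :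
  measurable_fun setT phi -> (forall x, `|phi x| <= 1) ->
  (forall x y, `|phi x - phi y| <= `|x - y|) -> 0 < e -> 0 <= b ->
  (forall l : nat, (\int[mu]_(t in `[0%R, l%:R]) ((D t - partial_osc 0 n t) ^+ 2)%:E
      <= (l%:R * b)%:E)%E) ->
  forall T, 1 <= T ->
  `|time_mean (fun t => phi (lambda * D t)) T -
    time_mean (fun t => phi (lambda * partial_osc 0 n t)) T|
    <= e + lambda ^+ 2 / e * (2 * b).
Proof.
move=> mphi phi1 lip e0 b0 H T T1.
have T0 : 0 < T by rewrite (lt_le_trans ltr01).
have bmphi (f : R -> R) : measurable_fun setT f ->
    bounded_measurable (fun t => phi (lambda * f t)).
  move=> mf; split; last by exists 1.
  by apply: measurableT_comp => //; exact: measurable_funM.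
have bD := bmphi _ mD.
have bx := bmphi _ (measurable_partial_osc 0 n).
have mDx : measurable_fun setT (fun t => (D t - partial_osc 0 n t) ^+ 2).
  by apply: measurable_funX; apply: measurable_funB => //; exact: measurable_partial_osc.
pose l := (Num.truncn T).+1.
have lT : T <= l%:R by rewrite ltW// truncnS_gt.
have l2 : l%:R <= 2 * T.
  have /andP[h _] := truncn_itv (ltW T0).
  by rewrite /l -natr1 (_ : 2 = 1 + 1)// mulrDl mul1r lerD.
have HT : (\int[mu]_(t in `[0%R, T]) ((D t - partial_osc 0 n t) ^+ 2)%:E <= (2 * T * b)%:E)%E.
  apply: le_trans (_ : ((l%:R * b)%:E <= _)%E); last by rewrite lee_fin ler_wpM2r.
  apply: le_trans (H l); apply: ge0_subset_integral => //.
  - by apply: measurable_funTS; exact/measurable_EFinP.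
  - by move=> t _; rewrite lee_fin sqr_ge0.
  - by move=> t; rewrite /= !in_itv/= => /andP[-> /le_trans]; apply.
have int2 : mu.-integrable `[0, T] (EFin \o (fun t => (D t - partial_osc 0 n t) ^+ 2)).
  apply/integrableP; split; first by apply: measurable_funTS; exact/measurable_EFinP.
  under eq_integral do rewrite /= ger0_norm ?sqr_ge0//.
  by rewrite (le_lt_trans HT)// ltry.
have HTR : Rintegral mu `[0, T] (fun t => (D t - partial_osc 0 n t) ^+ 2) <= 2 * T * b.
  rewrite -lee_fin /Rintegral fineK//; exact: integrable_fin_num.
have ie := bounded_measurable_integrable _ 0 T (bounded_measurable_cst e).
have int2' : mu.-integrable `[0, T] (EFin \o (fun t => lambda ^+ 2 / e * (D t - partial_osc 0 n t) ^+ 2)).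
  by apply: (integrableZl _ (lambda ^+ 2 / e)%R int2).
rewrite /time_mean -mulrBr normrM gtr0_norm ?invr_gt0// mulrC ler_pdivrMr//.
rewrite -RintegralB//=; [|exact: bounded_measurable_integrable..].
have bB := bounded_measurableB _ _ bD bx.
rewrite (le_trans (le_normr_Rintegral _ _))//; first exact: bounded_measurable_integrable.
rewrite (@le_trans _ _ (Rintegral mu `[0, T]
   (fun t => e + lambda ^+ 2 / e * (D t - partial_osc 0 n t) ^+ 2)))//.
  apply: le_Rintegral => //.
  - apply: (bounded_measurable_integrable (fun t => `|phi (lambda * D t) - phi (lambda * partial_osc 0 n t)|)).
    case: bB => mB [B hB]; split; first exact: measurableT_comp.
    by exists B => t; rewrite normr_id.
  - exact: (@integrableD _ _ _ mu `[0, T]%classic (measurable_itv _) _ _ ie int2').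
  move=> t _; rewrite (le_trans (lip _ _))// -mulrBr.
  set u := lambda * _.
  rewrite mulrAC -exprMn -/u -(real_normK (num_real u)).
  have [ue|eu] := leP `|u| e.
    by rewrite ler_wpDr// divr_ge0 ?sqr_ge0// ltW.
  rewrite ler_wpDl ?(ltW e0)// ler_pdivlMr// expr2 ler_wpM2l// ltW//.
rewrite RintegralD//= (Rintegral_itv_cst _ _ _ (ltW T0)) RintegralZl//= subr0 mulrDl lerD//.
rewrite -[leRHS]mulrA ler_wpM2l ?divr_ge0 ?sqr_ge0 ?(ltW e0)//.
by rewrite (le_trans HTR)// mulrAC.
Qed.

(* Arbitrarily late tails are small in mean square, up to all times. *)
Context (zi : rationally_independent z).
Context (good : forall q m : nat, exists n, (m <= n)%N /\
  forall N0, exists N, (N0 <= N)%N /\ forall l, (l <= N)%N ->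
    (\int[mu]_(t in `[0%R, l%:R]) ((partial_osc n N t) ^+ 2)%:E <= (l%:R * (q.+1%:R)^-1)%:E)%E).

(** By [time_mean_tail_le], the time means of the partial sums at the good indices
    approximate those of [D] uniformly in [T >= 1], so the limits in [n] and [T]
    may be exchanged. *)
Lemma has_mean_limit (phi : R -> R) (lambda : R) (p : nat -> R) (l : R) :
  measurable_fun setT phi -> (forall x, `|phi x| <= 1) ->
  (forall x y, `|phi x - phi y| <= `|x - y|) ->
  (forall n, has_mean (fun t => phi (lambda * partial_osc 0 n t)) (p n)) ->
  p n @[n --> \oo] --> l ->
  has_mean (fun t => phi (lambda * D t)) l.
Proof.
move=> mphi phi1 lip hp pl; apply/cvgrPdist_le => e e0.
have e4 : 0 < e / 4 by rewrite divr_gt0.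
pose q := Num.truncn (lambda ^+ 2 / (e / 4) * 2 / (e / 4)).
have hq : lambda ^+ 2 / (e / 4) * (2 * (q.+1%:R)^-1) <= e / 4.
  by rewrite mulrA ler_pdivrMr// [leRHS]mulrC -ler_pdivrMr// ltW// truncnS_gt.
have [m _ hm] : \forall n \near \oo, `|l - p n| <= e / 4 by move/cvgrPdist_le : pl; apply.
have [n [mn hn]] := good q m.
have tail (L : nat) : (\int[mu]_(t in `[0%R, L%:R]) ((D t - partial_osc 0 n t) ^+ 2)%:E
      <= (L%:R * (q.+1%:R)^-1)%:E)%E.
  apply: integral_sqr_tail_le => N0.
  have [N [hN hl]] := hn (maxn N0 L).
  by exists N; split; [exact: leq_trans (leq_maxl _ _) hN|apply: hl; exact: leq_trans (leq_maxr _ _) hN].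
near=> T.
have T1 : 1 <= T by near: T; apply: nbhs_pinfty_ge; exact: num_real.
have h1 := time_mean_tail_le phi lambda (e / 4) _ n mphi phi1 lip e4 _ tail T T1.
have h2 : `|p n - time_mean (fun t => phi (lambda * partial_osc 0 n t)) T| <= e / 4.
  by near: T; move/cvgrPdist_le : (hp n); apply.
have h3 := hm n mn.
have {}h1 := le_trans (h1 _) (lerD (lexx _) hq).
set A := time_mean _ T in h1 *; set B := time_mean _ T in h1 h2.
rewrite (_ : l - A = (l - p n) + (p n - B) + (B - A)); last by ring.
rewrite (_ : e = e / 4 + e / 4 + (e / 4 + e / 4)); last by field.
rewrite (le_trans (ler_normD _ _))// lerD//.
  by rewrite (le_trans (ler_normD _ _))// lerD.
by rewrite distrC h1.
Unshelve. all: by end_near. Qed.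

(** The constant [c] serves to obtain the sine, as a cosine delayed by a quarter
    turn. *)
Lemma has_mean_partial_osc (lambda c : R) n :
  has_mean (fun t => cos (c + lambda * partial_osc 0 n t))
    (cos c * \prod_(0 <= i < n) J0 (lambda * a i)).
Proof.
have := has_mean_quasiperiodic z (fun i => lambda * a i) th n c 0 zi (or_introl erefl).
rewrite eqxx; congr (has_mean _ _); apply/funext => t.
rewrite mul0r addr0 /partial_osc mulr_sumr; congr (cos (_ + _)).
by apply: eq_bigr => i _; rewrite mulrA.
Qed.

(** The factors are at most one in absolute value, so the increments of the
    partial products are bounded by [|J0 (b n) - 1| <= b n ^ 2]. *)
Lemma cvg_prod_J0 (b : nat -> R) : cvgn (series (fun i => b i ^+ 2)) ->
  cvgn (fun n => \prod_(0 <= i < n) J0 (b i)).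
Proof.
move=> sb; set p := fun n => _.
have p1 n : `|p n| <= 1.
  rewrite /p; elim: n => [|n ih]; first by rewrite big_nil normr1.
  by rewrite big_nat_recr//= normrM mulr_ile1// norm_J0_le1.
have sp : cvgn (series (telescope p)).
  apply: normed_cvg; apply: series_le_cvg sb => n; rewrite ?sqr_ge0 ?normr_ge0//.
  rewrite /= /telescope /p /= big_nat_recr//= -[X in _ - X]mulr1 -mulrBr normrM.
  rewrite -[leRHS]mul1r ler_pM// ?norm_J0_sub1_le//; exact: p1.
have -> : p = (fun n => series (telescope p) n + p 0%N).
  by apply/funext => n; rewrite /series/= telescope_sumr// subrK.
by apply: is_cvgD => //; exact: is_cvg_cst.
Qed.

Lemma pathwise_limit (lambda : R) : cvgn (series (fun i => a i ^+ 2)) ->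
  let p n := \prod_(0 <= i < n) J0 (lambda * a i) in
  [/\ cvgn p, has_mean (fun t => cos (lambda * D t)) (limn p) &
      has_mean (fun t => sin (lambda * D t)) 0].
Proof.
move=> sa p.
have cp : cvgn p.
  apply: cvg_prod_J0.
  have -> : series (fun i => (lambda * a i) ^+ 2) =
      (fun n => lambda ^+ 2 * series (fun i => a i ^+ 2) n).
    apply/funext => n; rewrite /series/= mulr_sumr; apply: eq_bigr => i _.
    by rewrite exprMn.
  by apply: is_cvgM => //; exact: is_cvg_cst.
split => //.
- apply: (has_mean_limit (@cos R) lambda p) => //.
  + by apply: continuous_measurable_fun; exact: continuous_cos.
  + exact: cos_max.
  + exact: lipschitz_cos.
  + move=> n; have := has_mean_partial_osc lambda 0 n.
    rewrite cos0 mul1r; congr (has_mean _ _); apply/funext => t.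
    by rewrite add0r.
- apply: (has_mean_limit (@sin R) lambda (fun=> 0)) => //.
  + by apply: continuous_measurable_fun; exact: continuous_sin.
  + exact: sin_max.
  + exact: lipschitz_sin.
  + move=> n; have := has_mean_partial_osc lambda (- (pi / 2)) n.
    rewrite cosN cos_pihalf mul0r; congr (has_mean _ _); apply/funext => t.
    by rewrite addrC cosBpihalf.
  + exact: cvg_cst.
Qed.

End pathwise.

(** * Almost sure convergence and densities *)

Section almost_sure_tools.
Local Open Scope ereal_scope.
Context {d : measure_display} {Omega : measurableType d} {R : realType}.
Context {P : probability Omega R}.
Local Notation mu := (@lebesgue_measure R).

(** Almost sure convergence at each fixed time gives, almost surely, convergence
    at almost every time, the exceptional set being measurable in the product. *)
Lemma ae_cvg_fubini (f : nat -> Omega * R -> R) (g : Omega * R -> R) :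
  (forall n, measurable_fun setT (f n)) -> measurable_fun setT g ->
  (forall t, {ae P, forall w, f n (w, t) @[n --> \oo] --> g (w, t)}) ->
  {ae P, forall w, {ae mu, forall t, f n (w, t) @[n --> \oo] --> g (w, t)}}.
Proof.
move=> mf mg fg.
pose h n p : \bar R := `|f n p - g p|%:E.
have mh n : measurable_fun setT (h n).
  by apply/measurable_EFinP; apply: measurableT_comp => //; exact: measurable_funB.
pose A : set (Omega * R) := [set p | 0 < limn_esup (h ^~ p)].
have mA : measurable A.
  have := emeasurable_fun_o_infty measurableT (measurable_fun_limn_esup mh) 0.
  by rewrite setTI.
have cvA w t : f n (w, t) @[n --> \oo] --> g (w, t) -> ~ A (w, t).
  move=> cv; have : h n (w, t) @[n --> \oo] --> 0.
    apply: cvg_EFin; first exact: nearW.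
    rewrite -(normr0 R); apply: cvg_norm; rewrite -(subrr (g (w, t))).
    by apply: cvgB => //; exact: cvg_cst.
  by move/cvg_limn_einf_sup => [_ e]; rewrite /A /= e ltxx.
have Acv w t : ~ A (w, t) -> f n (w, t) @[n --> \oo] --> g (w, t).
  move/negP; rewrite -leNgt => le0.
  have : h n (w, t) @[n --> \oo] --> 0.
    by apply: limn_esup_le_cvg => // n; rewrite lee_fin.
  move/fine_cvgP => [_ cv]; apply/subr_cvg0.
  exact/norm_cvg0P.
pose F (p : Omega * R) : \bar R := (\1_A p)%:E.
have mF : measurable_fun setT F by apply/measurable_EFinP; exact: measurable_indic.
have F0 p : 0 <= F p by rewrite lee_fin.
have int0 : \int[P]_w \int[mu]_t F (w, t) = 0.
  rewrite (@fubini_tonelli _ _ Omega _ R P mu F mF F0).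
  apply: integral0_eq => t _.
  rewrite (_ : 0 = \int[P]_w cst 0 w); last by rewrite integral0.
  apply: ae_eq_integral => //.
    exact: (@measurable_fun_pair1 _ _ _ Omega R _ F t mF).
  apply: filterS (fg t) => w cv _; rewrite /F indicE memNset//.
  exact: cvA.
pose G w := \int[mu]_t F (w, t).
have mG : measurable_fun setT G by exact: measurable_fun_fubini_tonelli_F.
have G0 w : 0 <= G w by exact: integral_ge0.
have : ae_eq P setT G (cst 0).
  apply/ae_eq_integral_abs => //; rewrite -int0; apply: eq_integral => w _.
  by rewrite gee0_abs.
apply: filterS => w /(_ I) Gw.
have mFw : measurable_fun setT (fun t : R => F (w, t)).
  exact: (@measurable_fun_pair2 _ _ _ Omega R _ F w mF).
have : ae_eq mu setT (fun t => F (w, t)) (cst 0).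
  apply/ae_eq_integral_abs => //; rewrite -[RHS]Gw /G; apply: eq_integral => t _.
  by rewrite gee0_abs.
apply: negligibleS => t /= nt H; apply: nt; apply: Acv => At.
by move: (H I); rewrite /F indicE mem_set// => /eqP; rewrite eqe oner_eq0.
Qed.

(** The sum has a finite integral by monotone convergence. *)
Lemma ae_summable (f : nat -> Omega -> R) (M : R) :
  (forall k, measurable_fun setT (f k)) -> (forall k w, (0 <= f k w)%R) ->
  (forall N, \sum_(0 <= k < N) \int[P]_w (f k w)%:E <= M%:E) ->
  {ae P, forall w, cvgn (series (fun k => f k w))}.
Proof.
move=> mf f0 fM.
have mfE k : measurable_fun setT (fun w => (f k w)%:E) by exact/measurable_EFinP.
have fE0 k w : setT w -> 0 <= (f k w)%:E by move=> _; rewrite lee_fin.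
pose g w := \sum_(0 <= k <oo) (f k w)%:E.
have mg : measurable_fun setT g by apply: ge0_emeasurable_sum => // k w _ _; exact: fE0.
have g0 w : 0 <= g w by apply: nneseries_ge0 => k _ _; exact: fE0.
have ig : \int[P]_w g w <= M%:E.
  rewrite integral_nneseries//; apply: lime_le.
    by apply: is_cvg_nneseries => k _ _; apply: integral_ge0 => w; exact: fE0.
  exact: nearW.
have /(integrable_ae measurableT) : P.-integrable setT g.
  apply/integrableP; split => //.
  under eq_integral do rewrite gee0_abs//.
  by rewrite (le_lt_trans ig)// ltry.
apply: filterS => w /(_ I) gw.
apply: nondecreasing_is_cvgn; first exact: nondecreasing_series.
exists (fine (g w)) => _ [N _ <-].
rewrite -lee_fin fineK// /series/= -sumEFin.
by apply: nneseries_lim_ge => k *; exact: fE0.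
Qed.

(** The Radon-Nikodym derivative of [nu] is almost everywhere equal to [g], by
    uniqueness, which transfers the change of variables formula. *)
Lemma integral_density (nu : {finite_measure set (measurableTypeR R) -> \bar R})
    (g : R -> \bar R) (f : R -> \bar R) :
  measurable_fun setT g -> (forall x, 0 <= g x) ->
  (forall A, measurable A -> nu A = \int[mu]_(x in A) g x) ->
  measurable_fun setT f -> (forall x, 0 <= f x) ->
  \int[nu]_x f x = \int[mu]_x (f x * g x).
Proof.
move=> mg g0 nuE mf f0.
have dom : nu `<< mu.
  apply/null_content_dominatesP => A mA A0.
  rewrite nuE//; apply: null_set_integral => //.
  exact: measurable_funTS.
rewrite -(Radon_Nikodym_SigmaFinite.change_of_variables dom f0 measurableT mf).
have irn := Radon_Nikodym_SigmaFinite.f_integrable dom.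
have mrn := measurable_int _ irn.
apply: ae_eq_integral => //; try exact: emeasurable_funM.
apply: ae_eqe_mul2l.
apply: (@integral_ae_eq _ _ _ mu setT measurableT) => //.
move=> E _ mE.
by rewrite -nuE// (Radon_Nikodym_SigmaFinite.f_integral dom).
Qed.

End almost_sure_tools.

(** * Moments of the normal and exponential laws *)

Section concrete_laws.
Local Open Scope ereal_scope.
Context {d : measure_display} {Omega : measurableType d} {R : realType}.
Context {P : probability Omega R}.
Local Notation mu := (@lebesgue_measure R).

Lemma integral_law_density (Y : {RV P >-> R}) (g f : R -> \bar R) :
  measurable_fun setT g -> (forall x, 0 <= g x) ->
  (forall B, measurable B -> distribution P Y B = \int[mu]_(x in B) g x) ->
  measurable_fun setT f -> (forall x, 0 <= f x) ->
  \int[distribution P Y]_y f y = \int[mu]_y (f y * g y).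
Proof.
move=> mg g0 law mf f0.
have mY : measurable_fun setT (Y : Omega -> measurableTypeR R).
  by move=> _ B mB; exact: (measurable_funP Y measurableT B mB).
pose Y' : {RV P >-> measurableTypeR R} :=
  HB.pack (Y : Omega -> measurableTypeR R) (isMeasurableFun.Build _ _ _ _ _ mY).
rewrite (integral_distribution_law Y (distribution P Y'))//.
exact: (integral_density (distribution P Y')).
Qed.

(** A second moment is bounded by comparison with the normal density of twice the
    standard deviation: [y ^ 2 exp (- 3 y ^ 2 / 8)] is at most [8 / 3]. *)
Lemma sqr_normal_pdf_le (y : R) : (y ^+ 2 * normal_pdf 0 1 y <=
  8 / 3 * normal_peak 1 / normal_peak 2 * normal_pdf 0 2 y)%R.
Proof.
rewrite !normal_pdfE ?oner_eq0 ?pnatr_eq0// /normal_fun !subr0.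
have p1 : (0 < normal_peak (1 : R))%R by rewrite normal_peak_gt0 ?oner_eq0.
have p2 : (0 < normal_peak (2 : R))%R by rewrite normal_peak_gt0 ?pnatr_eq0.
rewrite (_ : 8 / 3 * normal_peak 1 / normal_peak 2 * (normal_peak 2 * expR (- y ^+ 2 / (2 ^+ 2 *+ 2)))
  = normal_peak 1 * (8 / 3 * expR (- y ^+ 2 / (2 ^+ 2 *+ 2))))%R; last first.
  by field; rewrite gt_eqF.
rewrite mulrCA ler_wpM2l ?(ltW p1)//.
rewrite (_ : - y ^+ 2 / (1 ^+ 2 *+ 2) = - (3 / 8 * y ^+ 2) + (- y ^+ 2 / (2 ^+ 2 *+ 2)))%R; last by field.
rewrite expRD mulrA ler_wpM2r ?expR_ge0//.
rewrite expRN ler_pdivrMr ?expR_gt0//.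
have := expR_ge1Dx (3 / 8 * y ^+ 2); set E := expR _ => h.
have : (3 / 8 * y ^+ 2 <= E)%R by rewrite (le_trans _ h)// lerDr.
lra.
Qed.

Lemma normal_second_moment (Y : {RV P >-> R}) :
  (forall B, measurable B -> distribution P Y B = normal_prob 0 1 B) ->
  \int[P]_w ((Y w) ^+ 2)%:E <= (8 / 3 * normal_peak 1 / normal_peak 2 : R)%:E.
Proof.
move=> law; set v := (8 / 3 * _ / _)%R.
have v0 : (0 <= v)%R.
  by rewrite /v !mulr_ge0 ?invr_ge0 ?normal_peak_ge0.
have mpdf (s : R) : measurable_fun setT (fun y : R => (normal_pdf 0 s y)%:E).
  by apply/measurable_EFinP; exact: measurable_normal_pdf.
have msq : measurable_fun setT (fun y : R => (y ^+ 2)%:E).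
  by apply/measurable_EFinP; apply: measurable_funX; exact: measurable_id.
have -> : \int[P]_w ((Y w) ^+ 2)%:E = \int[distribution P Y]_y (y ^+ 2)%:E.
  by rewrite ge0_integral_distribution// => y; rewrite lee_fin sqr_ge0.
rewrite (integral_law_density Y (fun y => (normal_pdf 0 1 y)%:E))//; last 2 first.
- by move=> y; rewrite lee_fin normal_pdf_ge0.
- by move=> y; rewrite lee_fin sqr_ge0.
apply: (@le_trans _ _ (\int[mu]_y (v%:E * (normal_pdf 0 2 y)%:E))).
  apply: ge0_le_integral => //.
  - by move=> y _; rewrite mule_ge0// lee_fin ?sqr_ge0 ?normal_pdf_ge0.
  - exact: (emeasurable_funM msq (mpdf 1%R)).
  - exact: (emeasurable_funM (measurable_cst v%:E) (mpdf 2%R)).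
  - by move=> y _; rewrite -!EFinM lee_fin; exact: sqr_normal_pdf_le.
rewrite ge0_integralZl//; do ?[exact: mpdf|by move=> y _; rewrite lee_fin normal_pdf_ge0].
by rewrite integral_normal_pdf mule1.
Qed.

(** The product with [exp (- y)] is half the density of the law of rate 2. *)
Lemma exponential_laplace (Y : {RV P >-> R}) :
  (forall B, measurable B -> distribution P Y B = exponential_prob 1 B) ->
  \int[distribution P Y]_y (expR (- y))%:E = (2^-1)%:E.
Proof.
move=> law.
have mpdf (s : R) : measurable_fun setT (fun y : R => (exponential_pdf s y)%:E).
  by apply/measurable_EFinP; exact: measurable_exponential_pdf.
have mexp : measurable_fun setT (fun y : R => (expR (- y))%:E).
  apply/measurable_EFinP; apply: measurableT_comp => //.
rewrite (integral_law_density Y (fun y => (exponential_pdf 1 y)%:E))//; last first.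
  by move=> y; rewrite lee_fin exponential_pdf_ge0.
transitivity (\int[mu]_y ((2^-1)%:E * (exponential_pdf (2 : R) y)%:E)).
  apply: eq_integral => y _; rewrite -!EFinM; congr EFin.
  have [y0|y0] := ltP y 0%R; first by rewrite !lt0_exponential_pdf// !mulr0.
  rewrite !exponential_pdfE// mul1r mulrA mulVf ?pnatr_eq0// mul1r -expRD.
  by congr expR; ring.
rewrite ge0_integralZl//; do ?[exact: mpdf|by move=> y _; rewrite lee_fin exponential_pdf_ge0].
by rewrite integral_exponential_pdf// mule1.
Qed.

End concrete_laws.

(** * Series of negative powers *)

Section power_series.
Context {R : realType}.

(** The increment of a decreasing power, by 1 + u <= expR u and
    ln (1 + u) <= u. *)
Lemma powR_telescope_le (s : R) (n : nat) : 0 < s ->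
  s * n.+2%:R `^ (- s - 1) <= n.+1%:R `^ (- s) - n.+2%:R `^ (- s).
Proof.
move=> s0.
have x0 : 0 < n.+1%:R :> R by rewrite ltr0n.
have y0 : 0 < n.+2%:R :> R by rewrite ltr0n.
have xy : n.+1%:R = n.+2%:R - 1 :> R by rewrite -[n.+2%:R]natr1 addrK.
have yI : n.+2%:R `^ (- s - 1) = n.+2%:R `^ (- s) / n.+2%:R :> R.
  rewrite powRD; last by rewrite (gt_eqF y0) implybT.
  by rewrite powR_inv1// ltW.
have E : n.+2%:R `^ (- s) * (1 + s / n.+2%:R) <= n.+1%:R `^ (- s) :> R.
  rewrite (@le_trans _ _ (n.+2%:R `^ (- s) * expR (s / n.+2%:R)))//.
    by rewrite ler_wpM2l ?powR_ge0// expR_ge1Dx.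
  rewrite /powR !gt_eqF// -expRD ler_expR.
  have : ln (n.+1%:R / n.+2%:R) <= - (n.+2%:R)^-1 :> R.
    rewrite (_ : n.+1%:R / n.+2%:R = 1 + - (n.+2%:R)^-1); last first.
      by rewrite xy mulrBl divff ?gt_eqF// mul1r.
    by rewrite le_ln1Dx// ltrN2 invf_lt1// ltr1n.
  rewrite lnM ?posrE ?invr_gt0// lnV ?posrE// => H.
  have := ler_wpM2l (ltW s0) H.
  move: (ln _) (ln _) (n.+2%:R^-1) => p q r; lra.
rewrite yI; move: E; rewrite mulrDr mulr1.
move: (n.+2%:R `^ (- s)) (n.+1%:R `^ (- s)) => A B.
rewrite mulrCA; move: (s * (A / _)) => c; lra.
Qed.

(** Comparison with a telescoping sum. *)
Lemma cvg_series_powR (p : R) : 1 < p -> cvgn (series (fun n => n.+1%:R `^ (- p))).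
Proof.
move=> p1; pose s := p - 1; have s0 : 0 < s by rewrite subr_gt0.
apply: nondecreasing_is_cvgn.
  by apply: nondecreasing_series => n _ _; exact: powR_ge0.
exists (1 + s^-1) => _ [N _ <-].
have key M : \sum_(0 <= i < M) i.+2%:R `^ (- p) <= s^-1 * (1 - M.+1%:R `^ (- s)).
  elim: M => [|M ih]; first by rewrite big_nil powR1 subrr mulr0.
  rewrite big_nat_recr//=; have := powR_telescope_le s M s0.
  rewrite (_ : - s - 1 = - p); last by rewrite /s; ring.
  rewrite mulrC -ler_pdivlMr// => h.
  rewrite (le_trans (lerD ih h))// le_eqVlt; apply/orP; left; apply/eqP.
  by rewrite [_ / s]mulrC -mulrDr; congr (_ * _); ring.
rewrite /series/=; case: N => [|N].
  by rewrite big_nil addr_ge0// invr_ge0 ltW.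
rewrite big_nat_recl//= powR1 lerD2l (le_trans (key N))//.
by rewrite ler_piMr ?invr_ge0 ?(ltW s0)// gerBl powR_ge0.
Qed.

End power_series.

(** * Sigma-algebras of all the other variables *)

Section other_events.
Local Open Scope ereal_scope.
Context {d : measure_display} {Omega : measurableType d} {R : realType}.
Context {P : probability Omega R}.
Implicit Types (A : set (set Omega)) (E : set Omega) (Y : nat -> {RV P >-> R}).

(** The pi-system of the events determined by [A] and by finitely many of the
    variables [Y j] with [j <> k]. *)
Definition other_events A Y (k : nat) : set (set Omega) :=
  [set E | exists E0 (n : nat) (B : nat -> set R), [/\ A E0, forall j, measurable (B j) &
    E = E0 `&` \bigcap_(j in [set j | (j < n)%N /\ j <> k]) Y j @^-1` B j]].

Lemma other_events_measurable A Y k : A `<=` measurable ->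
  other_events A Y k `<=` measurable.
Proof.
move=> Am _ [E0 [n [B [AE0 mB ->]]]]; apply: measurableI; first exact: Am.
by apply: bigcap_measurableType => j _; exact: measurable_preimage.
Qed.

Lemma other_events_base A Y k : A `<=` other_events A Y k.
Proof.
move=> E0 AE0; exists E0, 0%N, (fun=> setT); split => //.
rewrite (_ : [set j | _ ] = set0) ?bigcap_set0 ?setIT//.
by apply/seteqP; split => j //= [].
Qed.

Lemma other_events_coord A Y k i (B : set R) : A setT -> i <> k -> measurable B ->
  other_events A Y k (Y i @^-1` B).
Proof.
move=> AT ik mB; exists setT, i.+1, (fun j => if j == i then B else setT); split => //.
  by move=> j; case: ifP.
rewrite setTI; apply/seteqP; split => w /=.
  by move=> Bw j _ /=; case: eqP => // ->.
by move=> /(_ i) /=; rewrite eqxx; apply.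
Qed.

Lemma other_events_setI A Y k : setI_closed A -> setI_closed (other_events A Y k).
Proof.
move=> AI _ _ [E1 [n1 [B1 [AE1 mB1 ->]]]] [E2 [n2 [B2 [AE2 mB2 ->]]]].
exists (E1 `&` E2), (maxn n1 n2), (fun j => (if (j < n1)%N then B1 j else setT) `&`
  (if (j < n2)%N then B2 j else setT)); split; first exact: AI.
  by move=> j; apply: measurableI; case: ifP.
apply/seteqP; split => w /=.
  move=> [[E1w H1] [E2w H2]]; split => // j /= [_ jk]; split.
    by case: ifP => // jn; exact: H1.
  by case: ifP => // jn; exact: H2.
move=> [[E1w E2w] H]; split; split => // j /= [jn jk].
  by have := H j; rewrite /= leq_max jn => /(_ (conj isT jk)) [].
by have := H j; rewrite /= leq_max jn orbT => /(_ (conj isT jk)) [].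
Qed.

(** The variables [Y] are mutually independent and, as a whole, independent of
    [A]; both facts are used on the finitely many variables that occur. *)
Lemma other_events_independent A Y k : A `<=` measurable ->
  mutually_independent Y ->
  (forall E0 S, A E0 -> sigma_generated Y S -> P (E0 `&` S) = P E0 * P S) ->
  independent_of (other_events A Y k) (Y k).
Proof.
move=> Am indY indA _ B [E0 [n [B0 [AE0 mB0 ->]]]] mB.
pose J := [seq j <- iota 0 n | j != k].
have JE : [set j | (j < n)%N /\ j <> k] = [set` J].
  apply/seteqP; split => j /=; rewrite mem_filter mem_iota add0n leq0n/=.
    by move=> [-> /eqP ->].
  by move=> /andP[/eqP jk jn].
have uJ : uniq J by rewrite filter_uniq// iota_uniq.
have kJ : k \notin J by rewrite mem_filter eqxx.
have gen (K : seq nat) (D : nat -> set R) : (forall j, measurable (D j)) ->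
    sigma_generated Y (\bigcap_(j in [set` K]) Y j @^-1` D j).
  move=> mD.
  apply: (@bigcap_measurableType _ (g_sigma_algebraType
    [set A | exists k (B : set R), measurable B /\ A = Y k @^-1` B])) => j _.
  by apply: sub_sigma_algebra; exists j, (D j).
pose B' j := if j == k then B else B0 j.
have mB' j : measurable (B' j) by rewrite /B'; case: ifP.
rewrite JE -setIA (_ : _ `&` Y k @^-1` B = \bigcap_(j in [set` k :: J]) Y j @^-1` B' j).
  rewrite indA//; last exact: gen.
  rewrite indA//; last exact: gen.
  rewrite !indY//=; last by rewrite kJ.
  rewrite big_cons /B' eqxx [RHS]muleAC -[RHS]muleA.
  congr (_ * (_ * _)).
  rewrite big_seq [RHS]big_seq; apply: eq_bigr => j jJ.
  by rewrite ifF//; apply/negbTE; apply: contraNneq kJ => <-.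
apply/seteqP; split => w /=.
  move=> [H Bw] j /=; rewrite inE => /predU1P[->|jJ]; first by rewrite /B' eqxx.
  by rewrite /B' ifF; [exact: H|apply/negbTE; apply: contraNneq kJ => <-].
move=> H; split.
  move=> j /= jJ; have := H j; rewrite /= inE jJ orbT /B' ifF; first by apply.
  by apply/negbTE; apply: contraNneq kJ => <-.
by have := H k; rewrite /= inE eqxx /B' eqxx; apply.
Qed.

Lemma measurable_wrt_generator (C : set (set Omega)) (f : Omega -> R) :
  (forall B, measurable B -> C (f @^-1` B)) -> measurable_wrt C f.
Proof. by move=> H _ B mB; rewrite setTI; apply: sub_sigma_algebra; exact: H. Qed.

Definition trivial_events : set (set Omega) := [set setT].

Lemma trivial_events_measurable : trivial_events `<=` measurable.
Proof. by move=> _ ->. Qed.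

Lemma trivial_events_setI : setI_closed trivial_events.
Proof. by move=> _ _ -> ->; rewrite /trivial_events/= setIT. Qed.

(** Each member of a mutually independent family is independent of the
    sigma-algebra generated by the others. *)
Lemma mutually_independent_others Y k : mutually_independent Y ->
  independent_of <<s other_events trivial_events Y k >> (Y k).
Proof.
move=> indY; have Am := trivial_events_measurable.
apply: independent_of_pi_system.
- exact: other_events_measurable.
- exact: other_events_setI trivial_events_setI.
- exact: other_events_base.
- apply: other_events_independent => // _ S -> _.
  by rewrite setTI probability_setT mul1e.
Qed.

Lemma measurable_wrt_others Y k i : i <> k ->
  measurable_wrt (other_events trivial_events Y k) (Y i).
Proof.
by move=> ik; apply: measurable_wrt_generator => B mB; exact: other_events_coord.
Qed.

End other_events.

(** * Rational independence of the frequencies *)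

Section rational_independence.
Local Open Scope ereal_scope.
Context {d : measure_display} {Omega : measurableType d} {R : realType}.
Context {P : probability Omega R}.
Context (Z : nat -> {RV P >-> R}) (indZ : mutually_independent Z).
Context (atomless : forall k x, distribution P (Z k) [set x] = 0).

(** Given the other variables, a combination with a nonzero coefficient of [Z k]
    vanishes for at most one value of [Z k], which has probability zero. *)
Lemma ae_integer_combination_neq0 (s : nat -> int) (K k : nat) :
  (k < K)%N -> s k != 0%R ->
  {ae P, forall w, (\sum_(0 <= i < K) (s i)%:~R * Z i w != 0)%R}.
Proof.
move=> kK sk; pose C := other_events trivial_events Z k.
have Cm : C `<=` measurable by exact: other_events_measurable trivial_events_measurable.
pose f (p : g_sigma_algebraType C * R) : R :=
  (\sum_(0 <= i < K) (s i)%:~R * (if i == k then p.2 else Z i p.1))%R.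
have mf : measurable_fun setT f.
  apply: measurable_sum => i; apply: measurable_funM; first exact: measurable_cst.
  case: eqP => [_|ik]; first exact: measurable_snd.
  apply: (@measurableT_comp _ _ _ _ _ _ (Z i : g_sigma_algebraType C -> R)).
    exact: measurable_wrt_others.
  exact: measurable_fst.
have mB : measurable (f @^-1` [set 0%R]) by rewrite -[X in measurable X]setTI; exact: mf.
pose F (p : g_sigma_algebraType C * R) : \bar R := (\1_(f @^-1` [set 0%R]) p)%:E.
have mF : measurable_fun setT F by apply/measurable_EFinP; exact: measurable_indic.
have F0 p : 0 <= F p by rewrite lee_fin.
have fE w : f (w, Z k w) = (\sum_(0 <= i < K) (s i)%:~R * Z i w)%R.
  by apply: eq_bigr => i _ /=; case: eqP => // ->.
pose N := [set w | (\sum_(0 <= i < K) (s i)%:~R * Z i w)%R = 0%R].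
have mN : measurable N.
  have mg : measurable_fun setT (fun w => \sum_(0 <= i < K) (s i)%:~R * Z i w)%R.
    by apply: measurable_sum => i; apply: measurable_funM => //; exact: measurable_cst.
  by rewrite -[X in measurable X]setTI; exact: (mg measurableT _ (measurable_set1 0%R)).
exists N; split => //; last by move=> w /= /negP; rewrite negbK => /eqP.
have -> : P N = \int[P]_w F (w, Z k w).
  rewrite -[N]setIT -integral_indic//; apply: eq_integral => w _; rewrite /F !indicE.
  congr ((_ : bool)%:R%:E); apply/idP/idP; rewrite !inE /= fE//.
rewrite (integral_independent C (Z k) F Cm (mutually_independent_others Z k indZ) mF F0).
apply: integral0_eq => w _.
have mS : measurable [set y : R | f (w, y) = 0%R].
  rewrite -[X in measurable X]setTI.
  exact: (@measurable_fun_pair2 _ _ _ (g_sigma_algebraType C) R _ f w mf measurableT _ (measurable_set1 0%R)).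
have -> : \int[distribution P (Z k)]_y F (w, y) = distribution P (Z k) [set y : R | f (w, y) = 0%R].
  rewrite -[X in distribution _ _ X]setIT -integral_indic//.
have inj y y' : f (w, y) = 0%R -> f (w, y') = 0%R -> y = y'.
  move=> fy fy'; have : (f (w, y) - f (w, y') = 0)%R by rewrite fy fy' subrr.
  rewrite /f/= -sumrB (@big_cat_nat _ _ _ k)//=; last exact: ltnW.
  rewrite big_nat big1 ?add0r => [|i /andP[_ ik]]; last by rewrite ltn_eqF// subrr.
  rewrite big_ltn// eqxx big_nat big1 ?addr0 => [|i /andP[ki _]]; last by rewrite gtn_eqF// subrr.
  by rewrite -mulrBr => /eqP; rewrite mulf_eq0 intr_eq0 (negbTE sk)/= subr_eq0 => /eqP.
have [[y0 fy0]|ny] := pselect (exists y, f (w, y) = 0%R).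
  rewrite (_ : [set y | _] = [set y0]) ?atomless//.
  by apply/seteqP; split => y /=; [move=> fy; exact: inj fy fy0|move=> ->].
rewrite (_ : [set y | _] = set0) ?measure0//.
by apply/seteqP; split => y //= fy; apply: ny; exists y.
Qed.

(** There are countably many integer combinations, indexed by their finite lists of
    coefficients. *)
Lemma ae_rationally_independent : {ae P, forall w, rationally_independent (fun i => Z i w)}.
Proof.
pose Q (p : seq int * nat) w := (p.2 < size p.1)%N -> (nth 0 p.1 p.2 != 0)%R ->
  (\sum_(0 <= i < size p.1) (nth 0 p.1 i)%:~R * Z i w != 0)%R.
have aeQ : {ae P, forall w, forall n : nat,
    if unpickle n is Some p then Q p w else True}.
  apply/ae_foralln => n; case: unpickle => [[s k]|]; last exact: aeW.
  rewrite /Q/=; have [ks|ks] := ltnP k (size s); last by apply: aeW.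
  have [sk|sk] := eqVneq (nth 0 s k)%R 0%R; first by apply: aeW.
  by apply: filterS (ae_integer_combination_neq0 (fun i => nth 0%R s i) _ _ ks sk) => w H _ _.
apply: filterS aeQ => w H K n sum0 k kK.
apply/eqP; apply: contraT => nk.
have := H (pickle (mkseq n K, k)); rewrite pickleK /Q /= size_mkseq nth_mkseq// => /(_ kK nk).
rewrite (_ : \sum_(0 <= i < K) _ = 0)%R ?eqxx// -[RHS]sum0.
by apply: eq_big_nat => i /andP[_ iK]; rewrite nth_mkseq.
Qed.

End rational_independence.

(** * Growth of the arrival times *)

Section poisson_growth.
Local Open Scope ereal_scope.
Context {d : measure_display} {Omega : measurableType d} {R : realType}.
Context {P : probability Omega R}.
Context (Gam : nat -> {RV P >-> R}) (pGam : poisson_arrival_times 1 Gam).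
Local Notation W := (interarrival Gam).

Lemma arrival_sum k w : Gam k w = (\sum_(0 <= j < k.+1) W j w)%R.
Proof.
elim: k => [|k ih]; first by rewrite big_nat1.
by rewrite big_nat_recr//= -ih addrC subrK.
Qed.

(** The interarrival times are independent, and each contributes a factor 1/2. *)
Lemma integral_exp_arrival k : \int[P]_w (expR (- Gam k w))%:E = (2^-1 ^+ k.+1)%:E.
Proof.
have [indW lawW] := pGam.
have mexp (f : Omega -> R) : measurable_fun setT f -> measurable_fun setT (fun w => (expR (- f w))%:E).
  by move=> mf; apply/measurable_EFinP; apply: measurableT_comp => //; exact: measurableT_comp.
elim: k => [|k ih].
  rewrite expr1 -(exponential_laplace (W 0%N))//; last exact: lawW.
  rewrite ge0_integral_distribution//.
  by apply/measurable_EFinP; apply: measurableT_comp.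
pose C := other_events trivial_events W k.+1.
have Cm : C `<=` measurable by exact: other_events_measurable trivial_events_measurable.
have mG : measurable_fun setT (Gam k : g_sigma_algebraType C -> R).
  rewrite (_ : (Gam k : _ -> _) = (fun w : g_sigma_algebraType C =>
    \sum_(0 <= j < k.+1) (if (j < k.+1)%N then W j w else 0%R))%R); last first.
    apply/funext => w; rewrite arrival_sum; apply: eq_big_nat => i /andP[_ ik].
    by rewrite ik.
  apply: measurable_sum => j; case jk : (j < k.+1)%N; last exact: measurable_cst.
  by apply: measurable_wrt_others => jE; rewrite jE ltnn in jk.
pose F (p : g_sigma_algebraType C * R) : \bar R := (expR (- Gam k p.1) * expR (- p.2))%:E.
have mF : measurable_fun setT F.
  apply/measurable_EFinP; apply: measurable_funM; apply: measurableT_comp => //.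
    apply: measurableT_comp => //.
    by apply: (@measurableT_comp _ _ _ _ _ _ (Gam k : g_sigma_algebraType C -> R)).
  by apply: measurableT_comp => //; exact: measurable_snd.
have F0 p : 0 <= F p by rewrite lee_fin mulr_ge0 ?expR_ge0.
transitivity (\int[P]_w F (w, W k.+1 w)).
  apply: eq_integral => w _; rewrite /F/= -expRD; congr (expR _)%:E; ring.
rewrite (integral_independent C (W k.+1) F Cm (mutually_independent_others W k.+1 indW) mF F0).
rewrite exprSr EFinM -ih -ge0_integralZr//; last exact: mexp.
apply: eq_integral => w _; rewrite /F/=.
under eq_integral do rewrite EFinM.
rewrite ge0_integralZl//; last by apply/measurable_EFinP; apply: measurableT_comp.
by rewrite (exponential_laplace (W k.+1) (lawW k.+1)).
Qed.

(** An exponential Chebyshev bound, summed over [k]. The constant [c] is such that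
    [exp c / 2 < 1]: for [c = ln (4 / 3)] the bounds are the powers of 2/3. *)
Lemma arrival_growth : {ae P, forall w, \forall k \near \oo,
  (ln (4 / 3) * k.+1%:R <= Gam k w)%R}.
Proof.
pose c : R := ln (4 / 3).
have ec : (expR c = 4 / 3)%R by rewrite lnK// posrE divr_gt0.
pose f k w : R := expR (c * k.+1%:R - Gam k w).
have mf k : measurable_fun setT (f k).
  by apply: measurableT_comp => //; apply: measurable_funB => //; exact: measurable_cst.
have intf k : \int[P]_w (f k w)%:E = ((2 / 3) ^+ k.+1)%:E.
  under eq_integral do rewrite /f expRD EFinM.
  rewrite ge0_integralZl//; last first.
    by apply/measurable_EFinP; apply: measurableT_comp => //; exact: measurableT_comp.
  rewrite integral_exp_arrival -EFinM expRM_natr ec -exprMn; congr (_ ^+ _)%:E.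
  by field.
have : {ae P, forall w, cvgn (series (fun k => f k w))}.
  apply: (ae_summable f 2%R) => //.
    by move=> k w; exact: expR_ge0.
  move=> N; under eq_bigr do rewrite intf.
  rewrite sumEFin lee_fin.
  have -> : (\sum_(0 <= i < N) (2 / 3) ^+ i.+1 = 2 * (1 - (2 / 3) ^+ N) :> R)%R.
    elim: N => [|N ih]; first by rewrite big_nil expr0 subrr mulr0.
    by rewrite big_nat_recr//= ih exprS; field.
  by rewrite ler_piMr// gerBl exprn_ge0// divr_ge0.
apply: filterS => w /cvg_series_cvg_0 /cvgr0_norm_lt /(_ _ ltr01) H.
apply: filterS H => k; rewrite ger0_norm ?expR_ge0// expR_lt1 subr_lt0.
exact: ltW.
Qed.

End poisson_growth.

(** * Complex limits *)

Section complex_limits.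
Context {R : realType}.

Lemma norm_complex_le (x y e : R) : `|x| <= e / 2 -> `|y| <= e / 2 ->
  `|(x +i* y : R[i])| <= e%:C.
Proof.
move=> xe ye; have e0 : 0 <= e / 2 by exact: le_trans xe.
rewrite normc_def lecR.
have -> : e = Num.sqrt (e ^+ 2) by rewrite sqrtr_sqr ger0_norm//; lra.
rewrite ler_wsqrtr// /=.
have x2 : x ^+ 2 <= (e / 2) ^+ 2 by rewrite -(real_normK (num_real x)) lerXn2r ?nnegrE.
have y2 : y ^+ 2 <= (e / 2) ^+ 2 by rewrite -(real_normK (num_real y)) lerXn2r ?nnegrE.
have : (e / 2) ^+ 2 = e ^+ 2 / 4 by field.
have := sqr_ge0 e; lra.
Qed.

Lemma cvg_complex {T : Type} (F : set_system T) {FF : Filter F} (u v : T -> R) (a b : R) :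
  u t @[t --> F] --> a -> v t @[t --> F] --> b ->
  (u t +i* v t : R[i]^o) @[t --> F] --> (a +i* b : R[i]^o).
Proof.
move=> /cvgrPdist_le ua /cvgrPdist_le vb; apply/cvgrPdist_le => -[e e'].
rewrite ltcE /= => /andP[/eqP -> e0].
have e2 : 0 < e / 2 by rewrite divr_gt0.
near=> t.
have := @norm_complex_le (a - u t) (b - v t) e.
apply; near: t; [exact: ua|exact: vb].
Unshelve. all: by end_near. Qed.

End complex_limits.

(** * Events determined by four sequences *)

Section joint_events.
Local Open Scope ereal_scope.
Context {d : measure_display} {Omega : measurableType d} {R : realType}.
Context {P : probability Omega R}.
Implicit Types (Y : nat -> {RV P >-> R}).

Lemma sigma_generated_measurable Y : sigma_generated Y `<=` measurable.
Proof.
apply: generated_measurable => _ [k [B [mB ->]]]; exact: measurable_preimage.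
Qed.

Lemma sigma_generatedT Y : sigma_generated Y setT.
Proof. exact: (@measurableT _ (g_sigma_algebraType _)). Qed.

Lemma sigma_generatedI Y : setI_closed (sigma_generated Y).
Proof. by move=> E F mE mF; exact: (@measurableI _ (g_sigma_algebraType _)). Qed.

Lemma sigma_generated_coord Y k (B : set R) : measurable B ->
  sigma_generated Y (Y k @^-1` B).
Proof. by move=> mB; apply: sub_sigma_algebra; exists k, B. Qed.

(** The pi-system generating the sigma-algebra of four sequences together. *)
Definition joint_events Y1 Y2 Y3 Y4 : set (set Omega) :=
  [set E | exists E1 E2 E3 E4, [/\ sigma_generated Y1 E1, sigma_generated Y2 E2,
    sigma_generated Y3 E3, sigma_generated Y4 E4 & E = E1 `&` E2 `&` E3 `&` E4]].

Lemma joint_events_measurable Y1 Y2 Y3 Y4 : joint_events Y1 Y2 Y3 Y4 `<=` measurable.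
Proof.
move=> _ [E1 [E2 [E3 [E4 [m1 m2 m3 m4 ->]]]]].
by do 3?apply: measurableI; [move: m1|move: m2|move: m3|move: m4];
  exact: sigma_generated_measurable.
Qed.

Lemma joint_eventsT Y1 Y2 Y3 Y4 : joint_events Y1 Y2 Y3 Y4 setT.
Proof.
exists setT, setT, setT, setT; rewrite !setIT.
by split => //; exact: sigma_generatedT.
Qed.

Lemma joint_events_setI Y1 Y2 Y3 Y4 : setI_closed (joint_events Y1 Y2 Y3 Y4).
Proof.
move=> _ _ [E1 [E2 [E3 [E4 [m1 m2 m3 m4 ->]]]]] [F1 [F2 [F3 [F4 [n1 n2 n3 n4 ->]]]]].
exists (E1 `&` F1), (E2 `&` F2), (E3 `&` F3), (E4 `&` F4).
split; [exact: sigma_generatedI..|].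
by rewrite setIACA (setIACA _ E3) (setIACA E1).
Qed.

Lemma joint_events_coord Y1 Y2 Y3 Y4 k (B : set R) : measurable B ->
  [/\ joint_events Y1 Y2 Y3 Y4 (Y1 k @^-1` B), joint_events Y1 Y2 Y3 Y4 (Y2 k @^-1` B),
      joint_events Y1 Y2 Y3 Y4 (Y3 k @^-1` B) & joint_events Y1 Y2 Y3 Y4 (Y4 k @^-1` B)].
Proof.
move=> mB; split.
- exists (Y1 k @^-1` B), setT, setT, setT; rewrite !setIT.
  by split => //; solve [exact: sigma_generatedT|exact: sigma_generated_coord].
- exists setT, (Y2 k @^-1` B), setT, setT; rewrite !setIT setTI.
  by split => //; solve [exact: sigma_generatedT|exact: sigma_generated_coord].
- exists setT, setT, (Y3 k @^-1` B), setT; rewrite !setIT setTI.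
  by split => //; solve [exact: sigma_generatedT|exact: sigma_generated_coord].
- exists setT, setT, setT, (Y4 k @^-1` B); rewrite !setIT setTI.
  by split => //; solve [exact: sigma_generatedT|exact: sigma_generated_coord].
Qed.

Lemma joint_events_independent Y1 Y2 Y3 Y4 Y5 :
  independent_sequences [tuple Y1; Y2; Y3; Y4; Y5] ->
  forall E S, joint_events Y1 Y2 Y3 Y4 E -> sigma_generated Y5 S ->
    P (E `&` S) = P E * P S.
Proof.
move=> ind _ S [E1 [E2 [E3 [E4 [m1 m2 m3 m4 ->]]]]] mS.
have key (F : set Omega) : sigma_generated Y5 F ->
    P (E1 `&` E2 `&` E3 `&` E4 `&` F) = P E1 * (P E2 * (P E3 * (P E4 * P F))).
  move=> mF; pose A (i : 'I_5) := nth setT [:: E1; E2; E3; E4; F] i.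
  have := ind A.
  have -> : \bigcap_(i in [set: 'I_5]) A i = E1 `&` E2 `&` E3 `&` E4 `&` F.
    apply/seteqP; split => w /=.
      move=> H; have H' (i : nat) (i5 : (i < 5)%N) := H (Ordinal i5) I.
      by do 4?split; [exact: (H' 0%N isT)|exact: (H' 1%N isT)|exact: (H' 2%N isT)
        |exact: (H' 3%N isT)|exact: (H' 4%N isT)].
    by move=> [[[[? ?] ?] ?] ?] [[|[|[|[|[|//]]]]] ?] _.
  rewrite !big_ord_recl big_ord0 mule1 /A/=; apply.
  by move=> [[|[|[|[|[|//]]]]] ?]; rewrite (tnth_nth Y1).
rewrite key// -[X in _ = P X * _]setIT key; last exact: sigma_generatedT.
by rewrite probability_setT mule1 -!muleA.
Qed.

End joint_events.

(** * The lag process *)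

Section lag_process.
Context {d : measure_display} {Omega : measurableType d} {R : realType}.
Context {P : probability Omega R}.
Context (alpha : R) (m : {finite_measure set R -> \bar R}).
Context (Gam G1 G2 Z Theta : nat -> {RV P >-> R}) (h : R).

Local Notation amp := (amplitude alpha m Gam G1 G2).

(** Amplitude and phase of the k-th term of the lag process, from
    cos (x + h) - cos x = 2 sin (h / 2) cos (x + (h + pi) / 2). *)
Definition lag_amplitude (k : nat) (w : Omega) : R := 2 * amp k w * sin (h * Z k w / 2).

Definition lag_phase (k : nat) (w : Omega) : R := (h * Z k w + pi) / 2.

Lemma lag_term k w t :
  amp k w * cos (Theta k w + (t + h) * Z k w) - amp k w * cos (Theta k w + t * Z k w) =
  lag_amplitude k w * cos (Theta k w + lag_phase k w + t * Z k w).
Proof.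
rewrite /lag_amplitude /lag_phase.
set y := Theta k w + t * Z k w + h * Z k w / 2.
rewrite (_ : Theta k w + (t + h) * Z k w = y + h * Z k w / 2); last by rewrite /y; field.
rewrite (_ : Theta k w + t * Z k w = y - h * Z k w / 2); last by rewrite /y; field.
rewrite (_ : Theta k w + (h * Z k w + pi) / 2 + t * Z k w = y + pi / 2); last by rewrite /y; field.
by rewrite cosDpihalf cosD cosB; ring.
Qed.

(** The arrival times grow linearly, so only finitely many terms are affected by
    this truncation, which keeps the negative power of the arrival time bounded. *)
Definition truncated_lag_amplitude (k : nat) (w : Omega) : R :=
  lag_amplitude k w * \1_(`[ln (4 / 3) * k.+1%:R, +oo[%classic : set R) (Gam k w).

Lemma measurable_amplitude d' (E : measurableType d') (gam g1 g2 : E -> R) (c : R) :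
  measurable_fun setT gam -> measurable_fun setT g1 -> measurable_fun setT g2 ->
  measurable_fun setT (fun w => c * gam w `^ (- alpha^-1) * Num.sqrt (g1 w ^+ 2 + g2 w ^+ 2)).
Proof.
move=> mgam mg1 mg2; apply: measurable_funM.
  apply: measurable_funM; first exact: measurable_cst.
  by apply: (@measurableT_comp _ _ _ _ _ _ (@powR R ^~ (- alpha^-1))) => //; exact: measurable_powR.
rewrite (_ : (fun w => _) = (fun w => (g1 w ^+ 2 + g2 w ^+ 2) `^ (2^-1))).
  apply: (@measurableT_comp _ _ _ _ _ _ (@powR R ^~ (2^-1))); first exact: measurable_powR.
  by apply: measurable_funD; exact: measurable_funX.
by apply/funext => w; rewrite powR12_sqrt// addr_ge0 ?sqr_ge0.
Qed.

Lemma measurable_truncated_lag_amplitude (C : set (set Omega)) k :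
  measurable_wrt C (Gam k) -> measurable_wrt C (G1 k) -> measurable_wrt C (G2 k) ->
  measurable_wrt C (Z k) -> measurable_wrt C (truncated_lag_amplitude k).
Proof.
move=> mG mG1 mG2 mZ; apply: measurable_funM; last first.
  by apply: (@measurableT_comp _ _ _ _ _ _ (\1_(`[ln (4 / 3) * k.+1%:R, +oo[%classic : set R) : R -> R)).
apply: measurable_funM.
  apply: measurable_funM; first exact: measurable_cst.
  exact: measurable_amplitude.
apply: (@measurableT_comp _ _ _ _ _ _ (@sin R)).
  by apply: continuous_measurable_fun; exact: continuous_sin.
apply: measurable_funM; last exact: measurable_cst.
by apply: measurable_funM => //; exact: measurable_cst.
Qed.

Lemma measurable_lag_phase (C : set (set Omega)) k :
  measurable_wrt C (Z k) -> measurable_wrt C (lag_phase k).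
Proof.
move=> mZ; apply: measurable_funM; last exact: measurable_cst.
apply: measurable_funD; last exact: measurable_cst.
by apply: measurable_funM => //; exact: measurable_cst.
Qed.

Context (halpha : 0 < alpha).

Let A0 : R := (C_ alpha * (b_ alpha)^-1 * fine (m setT)) `^ (alpha^-1).

Definition lag_constant : R := 4 * (A0 * ln (4 / 3) `^ (- alpha^-1)) ^+ 2.

Lemma sqr_truncated_lag_amplitude_le k w : truncated_lag_amplitude k w ^+ 2 <=
  lag_constant * k.+1%:R `^ (- (2 / alpha)) * (G1 k w ^+ 2 + G2 k w ^+ 2).
Proof.
have S0 : 0 <= G1 k w ^+ 2 + G2 k w ^+ 2 by rewrite addr_ge0 ?sqr_ge0.
have L0 : 0 <= lag_constant by rewrite mulr_ge0// sqr_ge0.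
rewrite /truncated_lag_amplitude indicE.
case: (boolP (_ \in _)) => [|_]; last first.
  by rewrite mulr0 expr0n/= mulr_ge0// mulr_ge0// powR_ge0.
rewrite inE /= in_itv/= andbT mulr1 => GamL.
have c0 : 0 < ln (4 / 3 : R) by rewrite ln_gt0//; lra.
have k0 : 0 < k.+1%:R :> R by rewrite ltr0n.
have r0 : 0 <= alpha^-1 by rewrite invr_ge0 ltW.
have ck0 : 0 < ln (4 / 3 : R) * k.+1%:R by rewrite mulr_gt0.
have Gam0 : 0 < Gam k w by exact: lt_le_trans GamL.
set x := Gam k w `^ (- alpha^-1).
have x0 : 0 <= x by exact: powR_ge0.
have xle : x <= ln (4 / 3) `^ (- alpha^-1) * k.+1%:R `^ (- alpha^-1).
  rewrite -powRM ?(ltW c0)// /x !powRN lef_pV2 ?posrE ?powR_gt0//.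
  by rewrite ge0_ler_powR// nnegrE ltW.
rewrite /lag_amplitude /amplitude -/A0 -/x.
set s := sin _.
have s1 : s ^+ 2 <= 1 by rewrite /s sin2cos2 gerBl sqr_ge0.
rewrite (_ : (2 * (A0 * x * Num.sqrt (G1 k w ^+ 2 + G2 k w ^+ 2)) * s) ^+ 2 =
  4 * A0 ^+ 2 * x ^+ 2 * Num.sqrt (G1 k w ^+ 2 + G2 k w ^+ 2) ^+ 2 * s ^+ 2); last by ring.
rewrite sqr_sqrtr//.
rewrite (@le_trans _ _ (4 * A0 ^+ 2 * x ^+ 2 * (G1 k w ^+ 2 + G2 k w ^+ 2)))//.
  by rewrite ler_piMr// mulr_ge0// mulr_ge0 ?sqr_ge0// mulr_ge0 ?sqr_ge0.
rewrite ler_wpM2r//.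
have -> : k.+1%:R `^ (- (2 / alpha)) = (k.+1%:R `^ (- alpha^-1)) ^+ 2 :> R.
  by rewrite -powR_mulrn ?powR_ge0// -powRrM; congr (_ `^ _); rewrite mulNr mulrC.
rewrite (_ : lag_constant * _ = 4 * A0 ^+ 2 *
  (ln (4 / 3) `^ (- alpha^-1) * k.+1%:R `^ (- alpha^-1)) ^+ 2); last by rewrite /lag_constant; ring.
rewrite ler_wpM2l//; first by rewrite mulr_ge0 ?sqr_ge0.
by rewrite lerXn2r ?nnegrE// mulr_ge0 ?powR_ge0.
Qed.

Context (iG1 : iid G1 (normal_prob 0 1)) (iG2 : iid G2 (normal_prob 0 1)).

Let v : R := 8 / 3 * normal_peak 1 / normal_peak 2.

(** On the event kept by the truncation the arrival time is at least
    [ln (4 / 3) (k + 1)], and the normal variables have finite second moments. *)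
Lemma second_moment_truncated_lag_amplitude k :
  (\int[P]_w (truncated_lag_amplitude k w ^+ 2)%:E <=
   (lag_constant * (2 * v) * k.+1%:R `^ (- (2 / alpha)))%:E)%E.
Proof.
have L0 : 0 <= lag_constant by rewrite mulr_ge0// sqr_ge0.
have [[_ l1] [_ l2]] := (iG1, iG2).
have v1 := normal_second_moment (G1 k) (l1 k).
have v2 := normal_second_moment (G2 k) (l2 k).
have mG (G : {RV P >-> R}) : measurable_fun setT (fun w => (G w ^+ 2)%:E).
  by apply/measurable_EFinP; exact: measurable_funX.
set D := lag_constant * k.+1%:R `^ (- (2 / alpha)).
have D0 : 0 <= D by rewrite mulr_ge0 ?powR_ge0.
have ma : measurable_fun setT (truncated_lag_amplitude k).
  apply: (measurable_wrtW measurable) => //.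
  have id_wrt (Y : {RV P >-> R}) : measurable_wrt measurable Y.
    by apply: measurable_wrt_generator => B mB; exact: measurable_preimage.
  exact: measurable_truncated_lag_amplitude.
apply: (@le_trans _ _ (\int[P]_w (D%:E * ((G1 k w ^+ 2)%:E + (G2 k w ^+ 2)%:E)))%E).
  apply: ge0_le_integral => //.
  - by move=> w _; rewrite lee_fin sqr_ge0.
  - by apply/measurable_EFinP; exact: measurable_funX.
  - by apply: emeasurable_funM; [exact: measurable_cst|exact: emeasurable_funD].
  - by move=> w _; rewrite -EFinD -EFinM lee_fin; exact: sqr_truncated_lag_amplitude_le.
rewrite ge0_integralZl//; do ?[exact: (emeasurable_funD (mG (G1 k)) (mG (G2 k))) |
  by move=> w _; rewrite -EFinD lee_fin addr_ge0 ?sqr_ge0].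
rewrite ge0_integralD//; do ?by move=> w _; rewrite lee_fin sqr_ge0.
rewrite (_ : lag_constant * (2 * v) * _ = D * (v + v)); last by rewrite /D; ring.
by rewrite (EFinM D) (EFinD v) lee_wpmul2l ?lee_fin// leeD.
Qed.

End lag_process.

(** * Time averages of the lag process *)

Theorem mainTheorem3 (R : realType) (d : measure_display)
    (Omega : measurableType d) (P : probability Omega R)
    (alpha : R) (halpha : 0 < alpha < 2)
    (m : {finite_measure set R -> \bar R}) (f : R -> R)
    (hf : symmetric_density m f) (hm : m setT = 1%E)
    (X : R -> Omega -> R) (hX : SRH P alpha m X)
    (Gam G1 G2 Z Theta : nat -> {RV P >-> R})
    (hvars : series_variables m Gam G1 G2 Z Theta)
    (hseries : measurable_series_version alpha m Gam G1 G2 Z Theta X)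
    (h : R) (hh : 0 < h) (lambda : R) :
  {ae P, forall w,
    let partial_prod (n : nat) : R[i] :=
      \prod_(0 <= k < n)
        besselJ0 (2 * lambda * amplitude alpha m Gam G1 G2 k w
                  * sin (h * Z k w / 2)) in
    let time_average (T : R) : R[i] :=
      (T^-1)%:C *
      cintegral lebesgue_measure `[0, T]
        (fun tau : R => cexpi (lambda * (X (tau + h) w - X tau w))) in
    cvgn (partial_prod : nat -> R[i]^o) /\
    (time_average T : R[i]^o) @[T --> +oo]
      --> limn (partial_prod : nat -> R[i]^o)}.
Proof.
have [a0 a2] := andP halpha.
have [pGam [iG1 iG2] [indZ lawZ] [indTh lawTh] indep] := hvars.
have [mX cvX] := hseries.
have [mf f0 _ mE] := hf.
pose J := joint_events Gam G1 G2 Z.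
have Jm : J `<=` measurable by exact: joint_events_measurable.
have JT : J setT by exact: joint_eventsT.
(* The events determined by all the variables except one phase. *)
pose C := other_events J Theta.
have Cm k : C k `<=` measurable by exact: other_events_measurable.
have Cind k : independent_of <<s C k >> (Theta k).
  apply: independent_of_pi_system => //.
  - by apply: other_events_setI; exact: joint_events_setI.
  - exact: other_events_base.
  - apply: other_events_independent => // E S JE mS.
    exact: (joint_events_independent _ _ _ _ _ indep).
have Cunif k : uniform_phase (Theta k) by move=> B mB; exact: lawTh.
have CJ (Y : nat -> {RV P >-> R}) i k :
    (forall B, measurable B -> J (Y i @^-1` B)) -> measurable_wrt (C k) (Y i).
  by move=> H; apply: measurable_wrt_generator => B mB; apply: other_events_base; exact: H.
have CGam i k : measurable_wrt (C k) (Gam i).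
  by apply: CJ => B mB; have [] := joint_events_coord Gam G1 G2 Z i B mB.
have CG1 i k : measurable_wrt (C k) (G1 i).
  by apply: CJ => B mB; have [] := joint_events_coord Gam G1 G2 Z i B mB.
have CG2 i k : measurable_wrt (C k) (G2 i).
  by apply: CJ => B mB; have [] := joint_events_coord Gam G1 G2 Z i B mB.
have CZ i k : measurable_wrt (C k) (Z i).
  by apply: CJ => B mB; have [] := joint_events_coord Gam G1 G2 Z i B mB.
have CTh i k : i <> k -> measurable_wrt (C k) (Theta i).
  by move=> ik; apply: measurable_wrt_generator => B mB; exact: other_events_coord.
pose a' := truncated_lag_amplitude alpha m Gam G1 G2 Z h.
pose a := lag_amplitude alpha m Gam G1 G2 Z h.
pose c := lag_phase Z h.
have Ca i k : measurable_wrt (C k) (a' i) by exact: measurable_truncated_lag_amplitude.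
have mc : measurable_phases C c by move=> i k; exact: measurable_lag_phase.
have ma i : measurable_fun setT (a' i) by exact: measurable_wrtW (Cm 0%N) (Ca i 0%N).
(* M bounds the second moments of the truncated amplitudes, relative to
   (k + 1) ^ (- 2 / alpha). *)
pose M : R := lag_constant alpha m * (2 * (8 / 3 * normal_peak 1 / normal_peak 2)).
have M0 : 0 <= M.
  rewrite mulr_ge0//; first by rewrite mulr_ge0 ?sqr_ge0.
  by rewrite mulr_ge0// mulr_ge0 ?invr_ge0 ?normal_peak_ge0// mulr_ge0 ?normal_peak_ge0.
pose s := 2 / alpha.
have s1 : 1 < s by rewrite ltr_pdivlMr// mul1r.
pose u (k : nat) : R := k.+1%:R `^ (- s).
have cu : cvgn (series u) by exact: cvg_series_powR.
have u0 k : 0 <= u k by exact: powR_ge0.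
have mom k : (\int[P]_w (a' k w ^+ 2)%:E <= (M * u k)%:E)%E.
  exact: second_moment_truncated_lag_amplitude.
have serle n : series u n <= limn (series u).
  apply: nondecreasing_cvgn_le => //; apply: nondecreasing_series => k _ _; exact: u0.
(* The remainder of a convergent series bounds all partial tails at once. *)
pose rho (n : nat) : R := 2^-1 * M * (limn (series u) - series u n).
have a_rho n N : (n <= N)%N ->
    (\sum_(n <= i < N) (2^-1)%:E * \int[P]_w ((a' i w) ^+ 2)%:E <= (rho n)%:E)%E.
  move=> nN; apply: (@le_trans _ _ (\sum_(n <= i < N) (2^-1 * (M * u i))%:E)%E).
    by apply: lee_sum => i _; rewrite EFinM lee_wpmul2l// lee_fin invr_ge0.
  rewrite sumEFin lee_fin /rho -!mulr_sumr -mulrA ler_wpM2l ?invr_ge0// ler_wpM2l//.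
  rewrite (_ : \sum_(n <= i < N) u i = series u N - series u n) ?lerB//.
  by rewrite sub_series nN.
have rho0 : rho n @[n --> \oo] --> 0.
  rewrite -(mulr0 (2^-1 * M)) -(subrr (limn (series u))).
  by apply: cvgM; [exact: cvg_cst|apply: cvgB; [exact: cvg_cst|exact: cu]].
have tails := tail_small_ae Theta a' Z C Cm Cind Cunif Ca CZ CTh c mc rho a_rho rho0.
have sums : {ae P, forall w, cvgn (series (fun k => a' k w ^+ 2))}.
  apply: (ae_summable (fun k w => a' k w ^+ 2) (M * limn (series u))).
  - by move=> k; exact: measurable_funX.
  - by move=> k w; exact: sqr_ge0.
  - move=> N; apply: (@le_trans _ _ (\sum_(0 <= k < N) (M * u k)%:E)%E).
      by apply: lee_sum.
    by rewrite sumEFin lee_fin -mulr_sumr ler_wpM2l//; exact: serle.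
have growth := arrival_growth Gam pGam.
have ratind : {ae P, forall w, rationally_independent (fun i => Z i w)}.
  apply: ae_rationally_independent => // k x.
  by rewrite lawZ// mE// integral_set1.
pose D (p : Omega * R) := X (p.2 + h) p.1 - X p.2 p.1.
have mD : measurable_fun setT D.
  apply: measurable_funB.
    apply: (@measurableT_comp _ _ _ _ _ _ (fun p : R * Omega => X p.1 p.2) _ (fun p : Omega * R => (p.2 + h, p.1))) => //.
    apply: measurable_fun_pair; last exact: measurable_fst.
    by apply: measurable_funD; [exact: measurable_snd|exact: measurable_cst].
  apply: (@measurableT_comp _ _ _ _ _ _ (fun p : R * Omega => X p.1 p.2) _ (fun p : Omega * R => (p.2, p.1))) => //.
  by apply: measurable_fun_pair; [exact: measurable_snd|exact: measurable_fst].
have mamp k : measurable_fun setT (amplitude alpha m Gam G1 G2 k).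
  exact: measurable_amplitude.
pose F (n : nat) (p : Omega * R) := \sum_(0 <= k < n)
  a k p.1 * cos (Theta k p.1 + c k p.1 + p.2 * Z k p.1).
have FE n p : F n p =
    \sum_(0 <= k < n) amplitude alpha m Gam G1 G2 k p.1 * cos (Theta k p.1 + (p.2 + h) * Z k p.1) -
    \sum_(0 <= k < n) amplitude alpha m Gam G1 G2 k p.1 * cos (Theta k p.1 + p.2 * Z k p.1).
  by rewrite -sumrB; apply: eq_bigr => k _; rewrite lag_term.
have mF n : measurable_fun setT (F n).
  have m1 (g : Omega -> R) : measurable_fun setT g -> measurable_fun setT (fun p : Omega * R => g p.1).
    by move=> mg; apply: (@measurableT_comp _ _ _ _ _ _ g) => //; exact: measurable_fst.
  rewrite (funext (FE n)).
  apply: measurable_funB; apply: measurable_sum => k; apply: measurable_funM; try exact: m1;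
    apply: measurable_cos_comp; apply: measurable_funD; try exact: m1;
    apply: measurable_funM; try exact: m1; last exact: measurable_snd.
  by apply: measurable_funD; [exact: measurable_snd|exact: measurable_cst].
have conv : {ae P, forall w, {ae lebesgue_measure, forall t : R,
    F n (w, t) @[n --> \oo] --> D (w, t)}}.
  apply: ae_cvg_fubini => // t.
  apply: filterS2 (cvX (t + h)) (cvX t) => w c1 c2.
  by under eq_fun do rewrite FE; exact: cvgB.
apply: filterS (filterI conv (filterI tails (filterI sums (filterI growth ratind)))).
move=> w [cw [tw [sw [gw rw]]]].
pose partial_prod (n : nat) : R[i] := \prod_(0 <= k < n)
  besselJ0 (2 * lambda * amplitude alpha m Gam G1 G2 k w * sin (h * Z k w / 2)).
pose time_average (T : R) : R[i] := (T^-1)%:C * cintegral lebesgue_measure `[0, T]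
  (fun tau : R => cexpi (lambda * (X (tau + h) w - X tau w))).
change (cvgn (partial_prod : nat -> R[i]^o) /\
  (time_average T : R[i]^o) @[T --> +oo] --> limn (partial_prod : nat -> R[i]^o)).
(* From n0 on, truncation has no effect for this outcome. *)
have [n0 _ gn0] := gw.
have aE k : (n0 <= k)%N -> a' k w = a k w.
  move=> /gn0 /= gk; rewrite /a' /truncated_lag_amplitude indicE mem_set ?mulr1//=.
  by rewrite in_itv/= andbT.
pose th k := Theta k w + c k w.
have mDw : measurable_fun setT (fun t => D (w, t)).
  exact: (@measurable_fun_pair2 _ _ _ Omega R _ D w mD).
have oscE n N t : osc Theta a Z c n N w t =
    partial_osc (fun k => a k w) th (fun k => Z k w) n N t.
  by apply: eq_bigr => k _; rewrite mulrC (mulrC t) mulrC.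
have good q0 m0 : exists n, (m0 <= n)%N /\ forall N0, exists N, (N0 <= N)%N /\
    forall l, (l <= N)%N -> (\int[lebesgue_measure]_(t in `[0%R, l%:R])
     ((partial_osc (fun k => a k w) th (fun k => Z k w) n N t) ^+ 2)%:E
       <= (l%:R * (q0.+1%:R)^-1)%:E)%E.
  have [n [hn Hn]] := tw q0 (maxn m0 n0).
  have n0n : (n0 <= n)%N by exact: leq_trans (leq_maxr _ _) hn.
  exists n; split; first exact: leq_trans (leq_maxl _ _) hn.
  move=> N0; have [N [hN HN]] := Hn N0; exists N; split => // l lN.
  apply: le_trans (HN l lN); rewrite le_eqVlt; apply/orP; left; apply/eqP.
  apply: eq_integral => t _; rewrite -oscE; congr (_ ^+ 2)%:E.
  apply: eq_big_nat => k /andP[nk _]; rewrite aE//; exact: leq_trans nk.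
have sa : cvgn (series (fun k => a k w ^+ 2)).
  rewrite -(is_cvg_series_restrict n0).
  rewrite (_ : [sequence _]_n = [sequence \sum_(n0 <= k < n) a' k w ^+ 2]_n).
    by rewrite is_cvg_series_restrict.
  by apply/funext => n; apply: eq_big_nat => k /andP[nk _]; rewrite aE.
have convw : {ae lebesgue_measure, forall t,
    partial_osc (fun k => a k w) th (fun k => Z k w) 0 N t @[N --> \oo] --> D (w, t)}.
  apply: negligibleS cw => t /= nt H; apply: nt.
  by under eq_fun do rewrite -oscE.
have [cp hcos hsin] := pathwise_limit _ _ _ _ mDw convw rw good lambda sa.
have ppE : partial_prod = fun n => (\prod_(0 <= i < n) J0 (lambda * a i w)) +i* 0 :> R[i]^o.
  apply/funext => n; rewrite /partial_prod.
  rewrite (_ : _ +i* 0 = (\prod_(0 <= i < n) J0 (lambda * a i w))%:C)// rmorph_prod.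
  apply: eq_bigr => k _; rewrite besselJ0E; congr (J0 _)%:C.
  by rewrite /a /lag_amplitude; ring.
have cpp : (partial_prod : nat -> R[i]^o) n @[n --> \oo] -->
    (limn (fun n => \prod_(0 <= i < n) J0 (lambda * a i w)) +i* 0 : R[i]^o).
  by rewrite ppE; apply: cvg_complex; [exact: cp|exact: cvg_cst].
split; first by apply/cvg_ex; eexists; exact: cpp.
rewrite (cvg_lim (@norm_hausdorff _ _) cpp).
have -> : time_average = fun T => time_mean (fun t => cos (lambda * D (w, t))) T +i*
    time_mean (fun t => sin (lambda * D (w, t))) T :> R[i]^o.
  apply/funext => T; rewrite /time_average /cintegral /time_mean /D /=.
  by apply/eqP; rewrite eq_complex /= !mul0r subr0 addr0 !eqxx.
exact: cvg_complex.
Qed.
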